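(* Suppose the measurable function class $\mathcal F$ has an envelope function bounded by $B>0$. Choose $F\equiv B$ and assume that the uniform entropy integral satisfies $J(1,\mathcal F,F)<\infty$. Suppose further that, for every $\epsilon>0$, $$\lim_{\delta\downarrow0}\limsup_{n\to\infty}\mathrm P_{\mathcal O}\Big(\sup_{f,g\in\mathcal F:\ \rho_{\mathrm P}(f,g)<\delta}\rho_{\mathrm Q_n}(f,g)>\epsilon\Big)=0.$$ Then for every $\epsilon,\eta>0$, $$\lim_{\delta\downarrow0}\limsup_{n\to\infty}\mathrm P_{\mathcal O}\Big\{\mathrm P_{\tilde U}\Big(\sup_{f,g\in\mathcal F:\ \rho_{\mathrm P}(f,g)<\delta}\big|\tilde{\mathbb G}_n[f]-\tilde{\mathbb G}_n[g]\big|>\epsilon\ \Big|\ \mathcal O\Big)>\eta\Big\}=0.$$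
   Context: Setting. $\mathrm P$ is a Borel probability measure on $\mathbb R^p$ and $Z_1,\dots,Z_n$ are i.i.d. from $\mathrm P$. $\mathrm P_U$ is a known base probability distribution. For each $n$, $\hat G_n$ is a (random) fitted generator mapping the base space into $\mathbb R^p$; $\mathcal O$ (depending on $n$) denotes all information (the induced $\sigma$-field) used to construct $\hat G_n$, including the data and any auxiliary training randomness, and $\mathrm P_{\mathcal O}$ is the induced probability on it. $\mathrm Q_n:=\hat G_n\#\mathrm P_U$ (pushforward) is a random probability measure on $\mathbb R^p$. Conditionally on $\mathcal O$, $\tilde Z_i=\hat G_n(\tilde U_i)$ with $\tilde U_1,\dots,\tilde U_n$ i.i.d. from $\mathrm P_U$, so $\tilde Z_1,\dots,\tilde Z_n$ are i.i.d. from $\mathrm Q_n$; $\mathrm P_{\tilde U}(\cdot\mid\mathcal O)$ is conditional probability with respect to this bootstrap randomness. $\tilde{\mathbb G}_n[f]:=\sqrt n\,(n^{-1}\sum_{i=1}^n f(\tilde Z_i)-\mathrm Q_n[f])$. Notation. $\mu f=\mu[f]=\int f\,d\mu$. $\rho_{\mathrm Q}(f,g)^2:=\mathrm Q[\{(f-g)-\mathrm Q[f-g]\}^2]$ for a probability measure $\mathrm Q$. For $0<u\le1$ and an envelope $F$ of $\mathcal F$, $$J(u,\mathcal F,F):=\int_0^u\sup_\Lambda\sqrt{1+\log\mathcal N\big(\epsilon\|F\|_{\Lambda,2},\mathcal F,L^2(\Lambda)\big)}\,d\epsilon,$$ where the supremum is over all probability measures $\Lambda$ on the sample space $\mathbb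 R^p$, $\|F\|_{\Lambda,2}=(\Lambda F^2)^{1/2}$, and $\mathcal N(\epsilon,\mathcal G,d)$ is the $\epsilon$-covering number of $\mathcal G$ with respect to the semimetric $d$. Standard measurability conditions are imposed so that all suprema and conditional probabilities are measurable. *)

(* Defs.v *)
From HB Require Import structures.
From mathcomp Require Import all_boot all_order all_algebra.
From mathcomp Require Import all_classical all_reals all_analysis measurable_realfun.

Set Implicit Arguments.
Unset Strict Implicit.
Unset Printing Implicit Defensive.

Import Order.TTheory GRing.Theory Num.Theory.
Import numFieldNormedType.Exports.

Local Open Scope classical_set_scope.
Local Open Scope ring_scope.

(* R^p with its Borel sigma-algebra. *)
Notation euclidean R p := (g_sigma_algebraType (@open 'rV[R]_p)).

Section FunctionClasses.
Context {d : measure_display} {T : measurableType d} {R : realType}.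
Implicit Types (Q P L : probability T R) (F : set (T -> R)) (f g E : T -> R).

Definition envelope F E := forall f x, F f -> `|f x| <= E x.

Definition rho Q f g : R :=
  Num.sqrt (\int[Q]_x ((f x - g x) - \int[Q]_y (f y - g y)) ^+ 2).

Definition L2norm L f : \bar R := ('N[L]_(2%:E) [EFin \o f])%E.

(* Least number of open L^2(L)-balls of radius r covering F. The centres are
   arbitrary elements of L^2(L), not necessarily in F; the value is +oo when no
   finite cover exists. *)
Definition covering_number (r : \bar R) F L : \bar R :=
  ereal_inf [set (n%:R)%:E | n in [set n : nat |
    exists c : 'I_n -> T -> R,
      (forall i, measurable_fun setT (c i) /\ (L2norm L (c i) < +oo)%E) /\
      (forall f, F f -> exists i, (L2norm L (fun x => f x - c i x)%R < r)%E)]].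

Definition uniform_entropy_integral (u : R) F E : \bar R :=
  (\int[lebesgue_measure]_(eps in `]0%R, u])
    ereal_sup [set sqrte (1 + lne (covering_number (eps%:E * L2norm L E) F L))
              | L in [set: probability T R]])%E.

Definition close_pairs P F (delta : R) : set ((T -> R) * (T -> R)) :=
  [set fg | F fg.1 /\ F fg.2 /\ rho P fg.1 fg.2 < delta].

(* The empirical process sqrt n (Q_n^emp - Q) of the sample z, at f. *)
Definition empirical_process n Q (z : 'I_n -> T) f : R :=
  Num.sqrt n%:R * (n%:R^-1 * (\sum_(i < n) f (z i)) - \int[Q]_x f x).

Definition sup_rho P Q F (delta : R) : \bar R :=
  ereal_sup [set (rho Q fg.1 fg.2)%:E | fg in close_pairs P F delta].

Definition modulus n P Q (z : 'I_n -> T) F (delta : R) : \bar R :=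
  ereal_sup [set (`|empirical_process Q z fg.1 - empirical_process Q z fg.2|)%:E
            | fg in close_pairs P F delta].

End FunctionClasses.

(* Measurability with respect to the completion of every probability law. *)
Definition universally_measurable {d : measure_display} {T : measurableType d}
    {R : realType} (f : T -> \bar R) :=
  forall mu : probability T R, exists2 g : T -> \bar R,
    measurable_fun setT g & {ae mu, forall x, f x = g x}.

(* The usual "measurable class" condition (van der Vaart and Wellner,
   Definition 2.3.3), imposed for all laws at once since it is used for the
   random laws Q_n. *)
Definition measurable_class {d : measure_display} {T : measurableType d}
    {R : realType} (H : set (T -> R)) :=
  forall (N : nat) (e : 'I_N -> R),
    universally_measurable (R := R) (fun x : N.-tuple T =>
      ereal_sup [set (`|\sum_(i < N) e i * h (tnth x i)|)%:E | h in H]).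

Section Conditioning.
Context {d : measure_display} {W : measurableType d} {R : realType}.
Implicit Types (Pr : probability W R) (O : set (set W)).

Definition sub_sigma_algebra_of O :=
  sigma_algebra setT O /\ O `<=` (measurable : set (set W)).

(* h is a version of the conditional probability of A given O. *)
Definition is_cond_probability Pr O (A : set W) (h : W -> R) :=
  [/\ measurable_fun setT (h : g_sigma_algebraType O -> R),
      Pr.-integrable setT (EFin \o h) &
      forall C, O C -> (\int[Pr]_(w in C) (h w)%:E = Pr (A `&` C))%E].

Context {d' : measure_display} {S : measurableType d'}.

Definition iid_from n Pr (X : 'I_n -> W -> S) (mu : probability S R) :=
  (forall i, measurable_fun setT (X i)) /\
  forall A : 'I_n -> set S, (forall i, measurable (A i)) ->
    (Pr (\bigcap_i (X i @^-1` A i)) = \prod_(i < n) mu (A i))%E.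

(* Given O, the X i are i.i.d. from mu: equivalently, they are i.i.d. from mu
   and jointly independent of O. *)
Definition iid_given n Pr O (X : 'I_n -> W -> S) (mu : probability S R) :=
  (forall i, measurable_fun setT (X i)) /\
  forall A : 'I_n -> set S, (forall i, measurable (A i)) ->
    is_cond_probability Pr O (\bigcap_i (X i @^-1` A i))
      (fun=> fine (\prod_(i < n) mu (A i))%E).

End Conditioning.

(* Main.v *)
(* Write h = f - g for a close pair. A ghost sample turns the centred bootstrap
   process over h into sums of h(x_i) - h(y_i) over two samples, whose law is
   invariant under exchanging x_i and y_i; so the signs of these differences may
   be randomised. Conditionally on the pooled sample the signed sums are
   sub-Gaussian for the pooled empirical L^2 distance, and chaining over dyadic
   covers (finite by the uniform entropy integral) makes them small as soon as
   the pairs h have small empirical variance. The latter follows from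
   rho_Q(f, g) <= t and uniform laws of large numbers for h and h^2, which come
   from the same symmetrization.

   The conditional probability is never computed: {PUt > eta} belongs to the
   conditioning sigma-algebra, so Markov's inequality reduces the claim to the
   unconditional probability of {modulus > eps}. As the suprema are not assumed
   jointly measurable in (w, u), every estimate produces a measurable set that
   covers the event of interest. *)
Require Import Defs.
From HB Require Import structures.
From mathcomp Require Import all_boot all_order all_algebra.
From mathcomp Require Import all_classical all_reals all_analysis measurable_realfun.
From mathcomp Require Import ring lra.

Set Implicit Arguments.
Unset Strict Implicit.
Unset Printing Implicit Defensive.

Import Order.TTheory GRing.Theory Num.Theory.
Import numFieldNormedType.Exports.

Local Open Scope classical_set_scope.
Local Open Scope ring_scope.

(** * Rademacher sums *)

Section Rademacher.
Context {R : realType}.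
Implicit Types (n : nat).

Notation signs n := {ffun 'I_n -> bool}.

(** The order of the choices shapes the proof. The radius [t] demanded of [rho_Q] is fixed before
    [n], [delta] and the random law; the event that [rho_Q] exceeds [t] is then simply added to the
    bound, and the semimetric hypothesis makes its probability vanish. Such a [t] exists because the
    entropy numbers bound covers for all laws at once, in particular for the empirical law of
    whatever pooled sample occurs.

    The generator is jointly measurable only for the conditioning sigma-algebra times that of the
    base space, so the first factor of the product space carries that sigma-algebra; there the pair
    of information and bootstrap draws has a product law, and an independent ghost sample can be
    adjoined.

    Measurability of the class is invoked for the law of the pooled sample of size [n + n], mixed
    over the generators. Its exceptional null set has to be spread over all exchanges of
    coordinates; there are only [2 ^ n] of them, so it stays null. *)

Definition rad_mean n (X : signs n -> R) : R := 2^-1 ^+ n * \sum_s X s.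

(** Events are arbitrary propositions: the sign space is finite, so an existential over an
    uncountable class raises no measurability question here. *)
Definition rad_pr n (A : signs n -> Prop) : R :=
  rad_mean (fun s => (`[< A s >])%:R).

Definition rad_sum n (s : signs n) (a : 'I_n -> R) : R :=
  \sum_(i < n) (-1) ^+ s i * a i.

Lemma ler_rad_mean n (X Y : signs n -> R) :
  (forall s, X s <= Y s) -> rad_mean X <= rad_mean Y.
Proof.
by move=> XY; rewrite ler_wpM2l ?exprn_ge0// ?invr_ge0//; exact: ler_sum.
Qed.

Lemma rad_mean_sum n (I : finType) (X : I -> signs n -> R) :
  rad_mean (fun s => \sum_i X i s) = \sum_i rad_mean (X i).
Proof. by rewrite /rad_mean exchange_big mulr_sumr. Qed.

Lemma rad_mean_cst n (c : R) : rad_mean (fun _ : signs n => c) = c.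
Proof.
rewrite /rad_mean sumr_const card_ffun card_bool card_ord -[c *+ _]mulr_natl natrX.
by rewrite mulrA -exprMn mulVf// expr1n mul1r.
Qed.

Lemma rad_meanZ n (c : R) (X : signs n -> R) :
  rad_mean (fun s => c * X s) = c * rad_mean X.
Proof. by rewrite /rad_mean -mulr_sumr mulrCA. Qed.

Lemma rad_pr_ge0 n (A : signs n -> Prop) : 0 <= rad_pr A.
Proof. by rewrite mulr_ge0 ?exprn_ge0 ?invr_ge0// sumr_ge0. Qed.

Lemma rad_pr0 n (A : signs n -> Prop) : (forall s, ~ A s) -> rad_pr A = 0.
Proof.
move=> A0; rewrite /rad_pr /rad_mean big1 ?mulr0// => s _.
by case: asboolP => // /A0.
Qed.

Lemma rad_pr_le1 n (A : signs n -> Prop) : rad_pr A <= 1.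
Proof.
rewrite -[leRHS](rad_mean_cst n); apply: ler_rad_mean => s.
by case: asboolP => _ /=; rewrite ?ler01.
Qed.

Lemma le_rad_pr n (A A' : signs n -> Prop) :
  (forall s, A s -> A' s) -> rad_pr A <= rad_pr A'.
Proof.
move=> AA'; apply: ler_rad_mean => s.
by do 2 case: asboolP => //=; rewrite ?ler01// => nA' /AA'.
Qed.

Lemma rad_pr_or n (A A' : signs n -> Prop) :
  rad_pr (fun s => A s \/ A' s) <= rad_pr A + rad_pr A'.
Proof.
rewrite /rad_pr /rad_mean -mulrDr -big_split/=.
rewrite ler_wpM2l ?exprn_ge0 ?invr_ge0//; apply: ler_sum => s _.
case: (asboolP (A s \/ A' s)) => [[]|] h; case: (asboolP (A s)) => // a;
  case: (asboolP (A' s)) => // a' /=; rewrite ?addr0 ?add0r ?lerDl ?lexx ?ler01 ?addr_ge0 //.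
Qed.

Lemma rad_pr_exists n (I : finType) (A : I -> signs n -> Prop) :
  rad_pr (fun s => exists i, A i s) <= \sum_i rad_pr (A i).
Proof.
rewrite /rad_pr -rad_mean_sum; apply: ler_rad_mean => s.
case: asboolP => [[i Ai]|_]; last by apply: sumr_ge0.
rewrite (bigD1 i)//= asboolT//= lerDl; exact: sumr_ge0.
Qed.

(* The optimal exponent is x ^+ 2 / 2; any multiple of x ^+ 2 serves here. *)
Lemma cosh_le_expR (x : R) : (expR x + expR (- x)) / 2 <= expR (2 * x ^+ 2).
Proof.
have [x2|x2] := ltP (x ^+ 2) 2^-1.
(* Here [expR x <= (1 - x)^-1] and its mirror image average to [(1 - x ^+ 2)^-1], which is at most
   [1 + 2 * x ^+ 2] in this range. In the other range [2 * x ^+ 2] already exceeds both [x] and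
   [- x]. *)
- have x1 : x < 1 by nra.
  have x1' : -1 < x by nra.
  have e1 : expR x <= (1 - x)^-1.
    rewrite -[x in expR x]opprK expRN lef_pV2 ?posrE ?expR_gt0//; last by lra.
    exact: expR_ge1Dx.
  have e2 : expR (- x) <= (1 + x)^-1.
    rewrite expRN lef_pV2 ?posrE ?expR_gt0//; last by lra.
    exact: expR_ge1Dx.
  apply: (@le_trans _ _ (1 + 2 * x ^+ 2)); last exact: expR_ge1Dx.
  apply: (@le_trans _ _ (1 - x ^+ 2)^-1).
    have -> : (1 - x ^+ 2)^-1 = ((1 - x)^-1 + (1 + x)^-1) / 2.
      field; apply/andP; split; [|apply/andP; split]; apply/eqP; nra.
    by rewrite ler_pM2r ?invr_gt0//; lra.
  rewrite -div1r ler_pdivrMr; nra.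
- have e1 : expR x <= expR (2 * x ^+ 2) by rewrite ler_expR; nra.
  have e2 : expR (- x) <= expR (2 * x ^+ 2) by rewrite ler_expR; nra.
  by rewrite ler_pdivrMr//; lra.
Qed.

Lemma rad_mean_expR n (a : 'I_n -> R) :
  rad_mean (fun s => expR (rad_sum s a)) <= expR (2 * \sum_i a i ^+ 2).
Proof.
have -> : rad_mean (fun s => expR (rad_sum s a)) =
    \prod_(i < n) ((expR (a i) + expR (- a i)) / 2).
  rewrite big_split/= prodr_const card_ord /rad_mean mulrC; congr (_ * _).
  transitivity (\prod_(i < n) \sum_(b : bool) expR ((-1) ^+ b * a i)).
    rewrite bigA_distr_bigA/=; apply: eq_bigr => s _.
    by rewrite /rad_sum expR_sum.
  apply: eq_bigr => i _; rewrite big_bool/= expr1 expr0 mul1r mulN1r.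
  by rewrite addrC.
rewrite mulr_sumr expR_sum; apply: ler_prod => i _.
by rewrite cosh_le_expR andbT divr_ge0// addr_ge0// expR_ge0.
Qed.

Lemma rad_sumN n (s : signs n) (a : 'I_n -> R) :
  rad_sum s (fun i => - a i) = - rad_sum s a.
Proof. by rewrite /rad_sum -sumrN; apply: eq_bigr => i _; rewrite mulrN. Qed.

Lemma rad_sumB n (s : signs n) (a b : 'I_n -> R) :
  rad_sum s (fun i => a i - b i) = rad_sum s a - rad_sum s b.
Proof. by rewrite /rad_sum -sumrB; apply: eq_bigr => i _; rewrite mulrBr. Qed.

Lemma rad_sumZ n (s : signs n) c (a : 'I_n -> R) :
  rad_sum s (fun i => c * a i) = c * rad_sum s a.
Proof. by rewrite /rad_sum mulr_sumr; apply: eq_bigr => i _; rewrite mulrCA. Qed.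

Lemma ler_norm_rad_sum n (s : signs n) (a : 'I_n -> R) :
  `|rad_sum s a| <= \sum_i `|a i|.
Proof.
apply: (le_trans (ler_norm_sum _ _ _)); apply: ler_sum => i _.
by rewrite normrM normrX normrN1 expr1n mul1r.
Qed.

Lemma rad_tail1 n (a : 'I_n -> R) (u S : R) :
  0 < u -> 0 < S -> \sum_i a i ^+ 2 <= S ->
  rad_pr (fun s => u < rad_sum s a) <= expR (- (u ^+ 2 / (8 * S))).
Proof.
(* Chernoff's method: this [l] minimises [- l * u + 2 * l ^+ 2 * S], with minimum
   [- u ^+ 2 / (8 * S)]. *)
move=> u0 S0 aS; pose l := u / (4 * S).
have l0 : 0 < l by rewrite divr_gt0// mulr_gt0.
apply: (@le_trans _ _ (rad_mean (fun s =>
    expR (- (l * u)) * expR (rad_sum s (fun i => l * a i))))).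
  apply: ler_rad_mean => s; case: asboolP => /= h.
    rewrite -expRD rad_sumZ -[leLHS]expR0 ler_expR addrC -mulrBr.
    by rewrite mulr_ge0 ?subr_ge0 ?ltW.
  by rewrite mulr_ge0 ?expR_ge0.
rewrite rad_meanZ; apply: (@le_trans _ _ (expR (- (l * u)) *
    expR (2 * \sum_i (l * a i) ^+ 2))).
  by rewrite ler_wpM2l ?expR_ge0// rad_mean_expR.
rewrite -expRD ler_expR.
under eq_bigr do rewrite exprMn.
rewrite -mulr_sumr.
apply: (@le_trans _ _ (- (l * u) + 2 * (l ^+ 2 * S))).
  by rewrite lerD2l ler_pM2l// ler_wpM2l// sqr_ge0.
rewrite /l le_eqVlt; apply/orP; left; apply/eqP; field; exact: lt0r_neq0.
Qed.

Lemma rad_tail n (a : 'I_n -> R) (u S : R) :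
  0 < u -> 0 < S -> \sum_i a i ^+ 2 <= S ->
  rad_pr (fun s => u < `|rad_sum s a|) <= 2 * expR (- (u ^+ 2 / (8 * S))).
Proof.
move=> u0 S0 aS.
apply: (@le_trans _ _ (rad_pr (fun s => u < rad_sum s a \/
    u < rad_sum s (fun i => - a i)))).
  apply: le_rad_pr => s; rewrite rad_sumN => h.
  by apply/orP; rewrite -ltr_normr.
apply: (le_trans (rad_pr_or _ _)).
rewrite mulr_natl mulr2n lerD//; first exact: rad_tail1.
apply: rad_tail1 => //; under eq_bigr do rewrite sqrrN; exact: aS.
Qed.

(** The exponential tail weakened by [expR (- y) <= y^-1]. This polynomial form is enough wherever
    the number of variables is fixed and only [S / u ^+ 2] is made small. *)
Lemma rad_chebyshev n (a : 'I_n -> R) (u S : R) :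
  0 < u -> 0 < S -> \sum_i a i ^+ 2 <= S ->
  rad_pr (fun s => u < `|rad_sum s a|) <= 16 * S / u ^+ 2.
Proof.
move=> u0 S0 aS; apply: (le_trans (rad_tail u0 S0 aS)).
set y := u ^+ 2 / (8 * S).
have y0 : 0 < y by rewrite divr_gt0 ?exprn_gt0// mulr_gt0.
have -> : 16 * S / u ^+ 2 = 2 * y^-1.
  by rewrite /y; field; rewrite !lt0r_neq0.
rewrite ler_pM2l// expRN lef_pV2 ?posrE ?expR_gt0//.
by apply: (le_trans _ (expR_ge1Dx _)); rewrite lerDr.
Qed.

End Rademacher.

(** * Chaining *)

Section Chaining.
Context {R : realType}.

(** Centres of a cover need not belong to the class; choosing a member of each occupied cell keeps
    the chain inside it. [i0] serves the empty cells. *)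
Lemma choose_representatives (I : Type) (K : nat) (F : set I) (i0 : I) (j : I -> 'I_K) :
  F i0 -> exists rep : 'I_K -> I,
    forall f, F f -> F (rep (j f)) /\ j (rep (j f)) = j f.
Proof.
move=> Fi0.
have /choice[rep repP] : forall c : 'I_K, exists f : I,
    forall g, F g -> j g = c -> F f /\ j f = c.
  move=> c; have [[g [Fg gc]]|nog] := pselect (exists g, F g /\ j g = c).
    by exists g.
  by exists i0 => g Fg gc; exfalso; apply: nog; exists g.
by exists rep => f Ff; exact: (repP _ f).
Qed.

Lemma sum_sqrB_le n (a b c : 'I_n -> R) (S : R) :
  \sum_i (a i - c i) ^+ 2 <= S -> \sum_i (b i - c i) ^+ 2 <= S ->
  \sum_i (a i - b i) ^+ 2 <= 4 * S.
Proof.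
move=> aS bS.
apply: (@le_trans _ _ (\sum_i (2 * (a i - c i) ^+ 2 + 2 * (b i - c i) ^+ 2))).
  apply: ler_sum => i _; have := sqr_ge0 (a i - c i + (b i - c i)); nra.
rewrite big_split/= -!mulr_sumr; lra.
Qed.

(** Cauchy-Schwarz against the constant 1, obtained by summing [2 * r * |a i| <= a i ^+ 2 + r ^+ 2];
    the division by [r] forces the separate case [r = 0]. *)
Lemma ler_sum_norm_sqrt n (a : 'I_n -> R) (r : R) : 0 <= r ->
  \sum_i a i ^+ 2 <= n%:R * r ^+ 2 -> \sum_i `|a i| <= n%:R * r.
Proof.
rewrite le_eqVlt => /orP[/eqP<- |r0] ar.
  rewrite expr0n/= mulr0 in ar *.
  have a0 : \sum_i a i ^+ 2 = 0.
    by apply/eqP; rewrite eq_le ar sumr_ge0// => i _; exact: sqr_ge0.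
  rewrite big1// => i _.
  have /eqP := a0; rewrite psumr_eq0 => [/allP/(_ i)|k _]; last exact: sqr_ge0.
  by rewrite mem_index_enum => /(_ isT)/=; rewrite sqrf_eq0 => /eqP ->; rewrite normr0.
have -> : \sum_i `|a i| = (2 * r)^-1 * \sum_i (2 * r * `|a i|).
  by rewrite -mulr_sumr mulKf// mulf_neq0// gt_eqF.
rewrite ler_pdivrMl ?mulr_gt0//.
apply: (@le_trans _ _ (\sum_(i < n) (a i ^+ 2 + r ^+ 2))).
  apply: ler_sum => i _; rewrite -[a i ^+ 2]real_normK ?num_real//.
  have := sqr_ge0 (`|a i| - r); nra.
rewrite big_split/= sumr_const card_ord -[_ *+ n]mulr_natl; nra.
Qed.

Variables (n : nat) (I : Type) (F : set I) (a : I -> 'I_n -> R).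
Variables (K : nat -> nat) (j : forall k, I -> 'I_(K k)) (r : nat -> R).
Variable (rep : forall k, 'I_(K k) -> I).
Hypothesis n0 : (0 < n)%N.
Hypothesis r0 : forall k, 0 < r k.
Hypothesis rS : forall k, r k.+1 <= r k.
Hypothesis jr : forall k f g, F f -> F g -> j k f = j k g ->
  \sum_i (a f i - a g i) ^+ 2 <= n%:R * r k ^+ 2.
Hypothesis repP : forall k f, F f -> F (rep (j k f)) /\ j k (rep (j k f)) = j k f.

Let X s f := rad_sum s (a f).
Let pi k f := rep (j k f).

(** Both representatives share a cell with [f], so their squared distance is at most four times the
    bound at the coarser scale; hence [32 = 8 * 4]. The partitions need not be nested, and the union
    runs over all pairs of cells at the two scales. *)
Lemma chaining_step k (u : R) : 0 < u ->
  rad_pr (fun s => exists f, F f /\ u < `|X s (pi k.+1 f) - X s (pi k f)|) <=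
  (K k)%:R * (K k.+1)%:R * (2 * expR (- (u ^+ 2 / (32 * (n%:R * r k ^+ 2))))).
Proof.
move=> u0.
have nr0 : 0 < n%:R * r k ^+ 2 by rewrite mulr_gt0 ?ltr0n ?exprn_gt0.
apply: (@le_trans _ _ (rad_pr (fun s => exists c : 'I_(K k) * 'I_(K k.+1),
    (exists f, F f /\ j k f = c.1 /\ j k.+1 f = c.2) /\
    u < `|X s (rep c.2) - X s (rep c.1)|))).
  apply: le_rad_pr => s [f [Ff uf]].
  by exists (j k f, j k.+1 f); split => //=; exists f.
apply: (le_trans (rad_pr_exists _)).
rewrite -natrM -[X in (_ * X)%:R * _ ]card_ord -[X in (X * _)%:R * _ ]card_ord -card_prod.
rewrite mulr_natl -sumr_const; apply: ler_sum => -[c d] _ /=.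
have [[f [Ff [fc fd]]]|nof] := pselect (exists f, F f /\ j k f = c /\ j k.+1 f = d); last first.
  rewrite rad_pr0; first by rewrite mulr_ge0 ?expR_ge0.
  by move=> s [].
apply: (@le_trans _ _ (rad_pr (fun s =>
    u < `|rad_sum s (fun i => a (rep d) i - a (rep c) i)|))).
  by apply: le_rad_pr => s [_]; rewrite rad_sumB.
have -> : 32 * (n%:R * r k ^+ 2) = 8 * (4 * (n%:R * r k ^+ 2)) by ring.
apply: rad_tail => //; first by rewrite mulr_gt0.
have [Fc jc] := repP k Ff; have [Fd jd] := repP k.+1 Ff.
rewrite -fc -fd; apply: (@sum_sqrB_le _ _ _ (a f)).
  apply: (le_trans (jr Fd Ff jd)).
  by rewrite ler_pM2l ?ltr0n// lerXn2r ?nnegrE ?(ltW (r0 _)) ?rS.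
exact: jr Fc Ff jc.
Qed.

Lemma chaining_partial (u : nat -> R) (k0 m : nat) : (forall k, 0 < u k) ->
  rad_pr (fun s => exists f, F f /\
    \sum_(k0 <= k < k0 + m) u k < `|X s (pi (k0 + m) f) - X s (pi k0 f)|) <=
  \sum_(k0 <= k < k0 + m)
     (K k)%:R * (K k.+1)%:R * (2 * expR (- (u k ^+ 2 / (32 * (n%:R * r k ^+ 2))))).
Proof.
move=> u0; elim: m => [|m IH].
  rewrite addn0 !big_geq// rad_pr0// => s [f []].
  by rewrite subrr normr0 ltxx.
rewrite addnS !big_nat_recr/= ?leq_addr//.
apply: (le_trans _ (lerD IH (chaining_step _ (u0 _)))).
apply: (le_trans _ (rad_pr_or _ _)).
apply: le_rad_pr => s [f [Ff uf]].
have [h|h] := ltP (\sum_(k0 <= k < k0 + m) u k) `|X s (pi (k0 + m) f) - X s (pi k0 f)|.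
  by left; exists f.
right; exists f; split => //; rewrite ltNge; apply/negP => h'.
have := ler_normD (X s (pi (k0 + m).+1 f) - X s (pi (k0 + m) f))
  (X s (pi (k0 + m) f) - X s (pi k0 f)).
rewrite addrA subrK; lra.
Qed.

(** The chain stops at the finite scale [k0 + m]. What is left beyond it is bounded for every choice
    of signs by an L1 distance, so no limit along the chain and no separability is required. *)
Lemma chaining (u : nat -> R) (k0 m : nat) (v : R) : (forall k, 0 < u k) ->
  \sum_(k0 <= k < k0 + m) u k + n%:R * r (k0 + m) <= v ->
  rad_pr (fun s => exists f, F f /\ v < `|X s f - X s (pi k0 f)|) <=
  \sum_(k0 <= k < k0 + m)
     (K k)%:R * (K k.+1)%:R * (2 * expR (- (u k ^+ 2 / (32 * (n%:R * r k ^+ 2))))).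
Proof.
move=> u0 uv; apply: (le_trans _ (chaining_partial _ _ u0)).
apply: le_rad_pr => s [f [Ff uf]]; exists f; split=> //.
have [Fp jp] := repP (k0 + m) Ff.
have h : `|X s f - X s (pi (k0 + m) f)| <= n%:R * r (k0 + m).
  rewrite -rad_sumB; apply: (le_trans (ler_norm_rad_sum _ _)).
  by apply: ler_sum_norm_sqrt; [exact: ltW|exact: jr].
have := ler_normD (X s f - X s (pi (k0 + m) f)) (X s (pi (k0 + m) f) - X s (pi k0 f)).
rewrite addrA subrK; lra.
Qed.

End Chaining.

(** * Equicontinuity and uniform laws for Rademacher processes *)

Section Equicontinuity.
Context {R : realType}.

Lemma bounded_series_tail (b : nat -> R) (M : R) : (forall k, 0 <= b k) ->
  (forall m, \sum_(0 <= k < m) b k <= M) ->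
  forall t, 0 < t -> exists k0, forall m, \sum_(k0 <= k < k0 + m) b k <= t.
Proof.
move=> b0 bM t t0.
pose A := [set \sum_(0 <= k < m) b k | m in setT].
have supA : has_sup A.
  by split; [exists (\sum_(0 <= k < 0) b k), 0%N|exists M => _ [m _ <-]].
have [_ [k0 _ <-] h] := sup_adherent t0 supA.
exists k0 => m.
have : \sum_(0 <= k < k0 + m) b k <= sup A.
  by apply: ub_le_sup; [case: supA|exists (k0 + m)%N].
rewrite (big_cat_nat (leq0n k0) (leq_addr m k0))/=; lra.
Qed.

Lemma sum_succ_geometric m :
  \sum_(0 <= k < m) 2^-1 ^+ k * k.+1%:R + 2 * m.+2%:R * 2^-1 ^+ m = 4 :> R.
Proof.
elim: m => [|m IH]; first by rewrite big_geq// expr0; ring.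
rewrite big_nat_recr//= -[RHS]IH exprS -!natr1; by field.
Qed.

Lemma half_exp_small (x t : R) : 0 < t -> exists m, forall k, (m <= k)%N ->
  x * 2^-1 ^+ k <= t.
Proof.
move=> t0; exists (Num.bound `|x / t|) => k mk.
rewrite exprVn ler_pdivrMr ?exprn_gt0//.
rewrite -ler_pdivrMl// mulrC; apply: (@le_trans _ _ (Num.bound `|x / t|)%:R).
  by rewrite ltW// (le_lt_trans (ler_norm _))// archi_boundP.
by rewrite -natrX ler_nat (leq_trans mk)// ltnW// ltn_expl.
Qed.

Lemma expRN_nat_le (k : nat) : expR (- k%:R) <= 2^-1 ^+ k :> R.
Proof.
rewrite expRN exprVn lef_pV2 ?posrE ?expR_gt0 ?exprn_gt0//.
rewrite -[k%:R]mulr1 expRM_natl lerXn2r ?nnegrE ?expR_ge0//.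
by apply: (le_trans _ (expR_ge1Dx _)); rewrite -natr1.
Qed.

(** As [36 / 32 >= 1], the squares of [x] and [y] in the exponent cancel the two cardinalities, and
    the square of [k.+1] leaves the factor [expR (- k.+1%:R)]. *)
Lemma dyadic_union_bound (K K' : nat) (x y : R) (k : nat) : 0 <= x -> 0 <= y ->
  K%:R <= expR (x ^+ 2) -> K'%:R <= expR (y ^+ 2) ->
  K%:R * K'%:R * (2 * expR (- (36 / 32 * (x + y + k.+1%:R) ^+ 2))) <= 2^-1 ^+ k.
Proof.
move=> x0 y0 Kx Ky.
apply: (@le_trans _ _ (2 * expR (- k.+1%:R))); last first.
  have := expRN_nat_le k.+1; rewrite exprS; lra.
apply: (@le_trans _ _ (expR (x ^+ 2) * expR (y ^+ 2) *
    (2 * expR (- (36 / 32 * (x + y + k.+1%:R) ^+ 2))))).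
  by rewrite ler_wpM2r ?mulr_ge0 ?expR_ge0// ler_pM.
rewrite mulrCA ler_pM2l// -!expRD ler_expR.
have k1 : (1 : R) <= k.+1%:R by rewrite ler1n.
set z := k.+1%:R in k1 *.
have xy : 0 <= x * y by rewrite mulr_ge0.
have xz : 0 <= x * z by rewrite mulr_ge0// (le_trans _ k1).
have yz : 0 <= y * z by rewrite mulr_ge0// (le_trans _ k1).
nra.
Qed.

(** The radius [t] depends only on the entropy numbers and on the target accuracy, not on the sample
    or its size. Scales beyond some [k0] are handled by chaining; at [k0] the number of cells is
    bounded independently of [n], so a union bound over pairs of cells suffices. [H] is an arbitrary
    relation because closeness will be measured by another semimetric than the empirical one. *)
Lemma rad_equicontinuity (C : R) (e : nat -> R) (M : R) :
  0 < C -> (forall k, 0 <= e k) ->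
  (forall m, \sum_(0 <= k < m) 2^-1 ^+ k * e k <= M) ->
  forall s c : R, 0 < s -> 0 < c -> exists2 t : R, 0 < t &
  forall n (I : Type) (F : set I) (a : I -> 'I_n -> R), (0 < n)%N ->
  (forall k, exists K, exists j : I -> 'I_K, K%:R <= expR (e k ^+ 2) /\
     forall f g, F f -> F g -> j f = j g ->
       \sum_i (a f i - a g i) ^+ 2 <= n%:R * (C * 2^-1 ^+ k) ^+ 2) ->
  forall H : I -> I -> Prop,
  (forall f g, F f -> F g -> H f g ->
     \sum_i (a f i - a g i) ^+ 2 <= n%:R * t ^+ 2) ->
  rad_pr (fun x => exists f g, [/\ F f, F g, H f g &
     s * Num.sqrt n%:R < `|rad_sum x (fun i => a f i - a g i)|]) <= c.
Proof.
move=> C0 e0 eM s c s0 c0.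
(* Link thresholds divided by [sqrt n]: the two entropies pay for the pairs of adjacent cells,
   [k.+1] makes the probabilities summable, and [6 ^+ 2 / 32 > 1] is what [dyadic_union_bound]
   needs. *)
pose b k := 6 * C * 2^-1 ^+ k * (e k + e k.+1 + k.+1%:R).
have hk k : 0 < 2^-1 ^+ k :> R by rewrite exprn_gt0.
have b0 k : 0 < b k.
  by rewrite mulr_gt0// ?mulr_gt0// ltr_wpDl// addr_ge0.
have bM m : \sum_(0 <= k < m) b k <= 6 * C * (M + 2 * M + 4).
  rewrite (eq_bigr (fun k => 6 * C * (2^-1 ^+ k * e k + 2 * (2^-1 ^+ k.+1 * e k.+1) +
     2^-1 ^+ k * k.+1%:R))); last by move=> k _; rewrite /b exprS; field.
  rewrite -mulr_sumr ler_pM2l ?mulr_gt0//.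
  rewrite !big_split/= -mulr_sumr lerD//; last first.
    by rewrite -[leRHS](sum_succ_geometric m) lerDl !mulr_ge0// ltW.
  rewrite lerD// ler_pM2l//; apply: (le_trans _ (eM m.+1)).
  by rewrite [leRHS]big_nat_recl//= lerDr mulr_ge0// ltW.
have gM m : \sum_(0 <= k < m) 2^-1 ^+ k <= 4 :> R.
  rewrite -[leRHS](sum_succ_geometric m) -[leLHS]addr0 lerD//.
  by apply: ler_sum => k _; apply: ler_peMr; [exact: ltW|rewrite ler1n].
(* One tail for two series: a total of at most 1 gives [s / 16] for the thresholds and [c / 2] for
   the probabilities. *)
have [k0 tail] : exists k0, forall m,
    \sum_(k0 <= k < k0 + m) (16 / s * b k + 2 / c * 2^-1 ^+ k) <= 1.
  apply: (@bounded_series_tail _ (16 / s * (6 * C * (M + 2 * M + 4)) + 2 / c * 4)) => //.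
    by move=> k; apply: addr_ge0; apply: mulr_ge0; rewrite ?divr_ge0// ltW// divr_gt0.
  move=> m; rewrite big_split/= -!mulr_sumr lerD// ler_pM2l ?divr_gt0//.
have g0 m : 0 <= \sum_(k0 <= k < k0 + m) 2^-1 ^+ k :> R.
  by apply: sumr_ge0 => k _; exact: ltW.
have B0 m : 0 <= \sum_(k0 <= k < k0 + m) b k.
  by apply: sumr_ge0 => k _; exact: ltW.
have tailb m : \sum_(k0 <= k < k0 + m) b k <= s / 16.
  have := tail m; rewrite big_split/= -!mulr_sumr => h.
  have : 16 / s * \sum_(k0 <= k < k0 + m) b k <= 1.
    by apply: le_trans h; rewrite lerDl mulr_ge0// divr_ge0// ltW.
  by rewrite -ler_pdivlMl ?divr_gt0// mulr1 invf_div.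
have tailg m : \sum_(k0 <= k < k0 + m) 2^-1 ^+ k <= c / 2.
  have := tail m; rewrite big_split/= -!mulr_sumr => h.
  have : 2 / c * \sum_(k0 <= k < k0 + m) 2^-1 ^+ k <= 1.
    by apply: le_trans h; rewrite lerDr mulr_ge0// divr_ge0// ltW.
  by rewrite -ler_pdivlMl ?divr_gt0// mulr1 invf_div.
pose N := expR (e k0 ^+ 2).
have N0 : 0 < N by exact: expR_gt0.
(* The cap 1 gives [t ^+ 2 <= t]. There are at most [N ^+ 2] pairs of cells, and each costs
   [64 * t ^+ 2 / s ^+ 2]: the 16 of [rad_chebyshev] at level [s / 2]. *)
pose t := Num.min 1 (s ^+ 2 * c / (128 * N ^+ 2)).
have t0 : 0 < t by rewrite lt_min ltr01 divr_gt0 ?mulr_gt0 ?exprn_gt0.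
have tN : 64 * N ^+ 2 * t ^+ 2 / s ^+ 2 <= c / 2.
  have t2 : t ^+ 2 <= s ^+ 2 * c / (128 * N ^+ 2).
    apply: (@le_trans _ _ t); last by rewrite /t ge_min lexx orbT.
    by rewrite expr2 ger_pMr// /t ge_min lexx.
  rewrite ler_pdivrMr ?exprn_gt0// -ler_pdivlMl ?mulr_gt0 ?exprn_gt0//.
  apply: (le_trans t2); rewrite le_eqVlt; apply/orP; left; apply/eqP.
  by field; exact: lt0r_neq0.
exists t => // n I F a n0 cover H Ht.
have [[i0 Fi0]|F0] := pselect (exists i0, F i0); last first.
  rewrite rad_pr0 ?ltW// => x [f [g [Ff _ _ _]]]; apply: F0; by exists f.
pose K k := projT1 (cid (cover k)).
pose j k := projT1 (cid (projT2 (cid (cover k)))).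
have jP k := projT2 (cid (projT2 (cid (cover k)))).
rewrite -/(K _) -/(j _) in jP.
pose rep k := projT1 (cid (choose_representatives (j k) Fi0)).
have repP k := projT2 (cid (choose_representatives (j k) Fi0)).
rewrite -/(rep _) in repP.
have sn0 : 0 < Num.sqrt n%:R :> R by rewrite sqrtr_gt0 ltr0n.
(* The last scale may depend on [n], since the tail bounds hold for every [m]; it brings the
   deterministic remainder below [s * sqrt n / 16]. *)
have [m hm] := half_exp_small (n%:R * C) (divr_gt0 (mulr_gt0 s0 sn0) (ltr0n R 16)).
have C2 k : 0 < C * 2^-1 ^+ k by rewrite mulr_gt0.
pose u k := Num.sqrt n%:R * b k.
have chain : rad_pr (fun x => exists f, F f /\ s / 8 * Num.sqrt n%:R <
    `|rad_sum x (a f) - rad_sum x (a (rep k0 (j k0 f)))|) <= c / 2.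
  apply: (le_trans (@chaining _ n I F a K j (fun k => C * 2^-1 ^+ k) rep n0 C2 _ _ _ u k0 m _ _ _)).
  - move=> k; rewrite ler_pM2l// exprS; have := hk k; lra.
  - by move=> k f g; exact: (jP k).2.
  - by move=> k f; exact: repP.
  - by move=> k; rewrite mulr_gt0.
  - rewrite -mulr_sumr.
    have := hm (k0 + m)%N (leq_addl _ _); rewrite mulrA => h1.
    have h2 : Num.sqrt n%:R * \sum_(k0 <= k < k0 + m) b k <= Num.sqrt n%:R * (s / 16).
      by rewrite ler_pM2l.
    lra.
  - apply: (le_trans _ (tailg m)); apply: ler_sum => k _.
    have -> : u k ^+ 2 / (32 * (n%:R * (C * 2^-1 ^+ k) ^+ 2)) =
        36 / 32 * (e k + e k.+1 + k.+1%:R) ^+ 2.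
      rewrite /u /b exprMn sqr_sqrtr//; field.
      by rewrite !lt0r_neq0// ?ltr0n.
    apply: dyadic_union_bound => //; [exact: (jP k).1|exact: (jP k.+1).1].
(* Each pair of cells containing a pair in H gets one representative pair in H;
   any other pair in these cells differs from it by four chaining remainders. *)
pose cell (p q : I) (d : 'I_(K k0) * 'I_(K k0)) :=
  [/\ F p, F q, H p q & j k0 p = d.1 /\ j k0 q = d.2].
have /choice[w wP] : forall d, exists v : I * I,
    forall p q, cell p q d -> cell v.1 v.2 d.
  move=> d; have [[p [q pq]]|nopq] := pselect (exists p q, cell p q d).
    by exists (p, q).
  by exists (i0, i0) => p q pq; exfalso; apply: nopq; exists p, q.
pose Y x f := rad_sum x (a f).
apply: (@le_trans _ _ (rad_pr (fun x =>
    (exists f, F f /\ s / 8 * Num.sqrt n%:R <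
      `|rad_sum x (a f) - rad_sum x (a (rep k0 (j k0 f)))|) \/
    (exists d, (exists p q, cell p q d) /\ s / 2 * Num.sqrt n%:R <
      `|rad_sum x (fun i => a (w d).1 i - a (w d).2 i)|)))).
  apply: le_rad_pr => x [f [g [Ff Fg Hfg]]]; rewrite rad_sumB => fg.
  have [|nch] := pselect (exists f, F f /\ s / 8 * Num.sqrt n%:R <
      `|rad_sum x (a f) - rad_sum x (a (rep k0 (j k0 f)))|); first by left.
  right; exists (j k0 f, j k0 g).
  have fgc : cell f g (j k0 f, j k0 g) by [].
  split; first by exists f, g.
  have [] := wP _ f g fgc.
  move: (w _) => [p q]/= Fp Fq _ [pf qg]; rewrite rad_sumB.
  have close h : F h ->
      `|rad_sum x (a h) - rad_sum x (a (rep k0 (j k0 h)))| <= s / 8 * Num.sqrt n%:R.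
    by move=> Fh; rewrite leNgt; apply/negP => h'; apply: nch; exists h.
  have := close _ Ff; have := close _ Fg; have := close _ Fp; have := close _ Fq.
  rewrite pf qg !ler_norml => /andP[h1 h2] /andP[h3 h4] /andP[h5 h6] /andP[h7 h8].
  move: fg; rewrite !ltr_normr => /orP[fg|fg]; apply/orP; [left|right]; lra.
apply: (le_trans (rad_pr_or _ _)); rewrite [leRHS](splitr c) lerD//.
apply: (le_trans (rad_pr_exists _)).
apply: (@le_trans _ _ (\sum_(d : 'I_(K k0) * 'I_(K k0)) 64 * t ^+ 2 / s ^+ 2)).
  apply: ler_sum => d _.
  have [[p [q pq]]|nopq] := pselect (exists p q, cell p q d); last first.
    rewrite rad_pr0; last by move=> x [].
    by rewrite ltW// divr_gt0 ?mulr_gt0 ?exprn_gt0.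
  have [Fp Fq Hpq _] := wP _ _ _ pq.
  apply: (@le_trans _ _ (rad_pr (fun x => s / 2 * Num.sqrt n%:R <
      `|rad_sum x (fun i => a (w d).1 i - a (w d).2 i)|))).
    by apply: le_rad_pr => x [].
  apply: (le_trans (rad_chebyshev _ _ (Ht _ _ Fp Fq Hpq))).
  - by rewrite mulr_gt0// divr_gt0.
  - by rewrite mulr_gt0 ?ltr0n ?exprn_gt0.
  - rewrite exprMn sqr_sqrtr// le_eqVlt; apply/orP; left; apply/eqP.
    by field; rewrite !lt0r_neq0// ?ltr0n.
rewrite sumr_const card_prod card_ord -[_ *+ _]mulr_natl natrM.
apply: (le_trans _ tN).
rewrite (_ : 64 * N ^+ 2 * t ^+ 2 / s ^+ 2 = N * N * (64 * t ^+ 2 / s ^+ 2)); last by ring.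
apply: ler_wpM2r; first by rewrite ltW ?divr_gt0 ?mulr_gt0 ?exprn_gt0.
by apply: ler_pM => //; exact: (jP k0).1.
Qed.

(** One scale suffices at the level [n]: half of the threshold pays for replacing [f] by its
    representative, the other half for Chebyshev on each of the [K] representatives. *)
Lemma rad_glivenko_cantelli n (K : nat) (I : Type) (F : set I) (j : I -> 'I_K)
    (a : I -> 'I_n -> R) (c M : R) : (0 < n)%N -> 0 < c -> 0 < M ->
  (forall f g, F f -> F g -> j f = j g -> \sum_i `|a f i - a g i| <= n%:R * c) ->
  (forall f i, F f -> `|a f i| <= M) ->
  rad_pr (fun x => exists f, F f /\ n%:R * (2 * c) < `|rad_sum x (a f)|) <=
    K%:R * (16 * M ^+ 2 / c ^+ 2) / n%:R.
Proof.
move=> n0 c0 M0 jc aM.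
have n0' : 0 < n%:R :> R by rewrite ltr0n.
have cM : 0 <= 16 * M ^+ 2 / c ^+ 2 by rewrite ltW ?divr_gt0 ?mulr_gt0 ?exprn_gt0.
have [[i0 Fi0]|F0] := pselect (exists i0, F i0); last first.
  rewrite rad_pr0; first by apply: divr_ge0 => //; exact: mulr_ge0.
  by move=> x [f [Ff _]]; apply: F0; exists f.
have [rep repP] := choose_representatives j Fi0.
apply: (@le_trans _ _ (rad_pr (fun x => exists d, (exists f, F f /\ j f = d) /\
    n%:R * c < `|rad_sum x (a (rep d))|))).
  apply: le_rad_pr => x [f [Ff fc]]; exists (j f); split; first by exists f.
  have [Fr rf] := repP _ Ff.
  have := le_trans (ler_norm_rad_sum x _) (jc _ _ Ff Fr (esym rf)).
  rewrite rad_sumB => h.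
  have := ler_normD (rad_sum x (a f) - rad_sum x (a (rep (j f)))) (rad_sum x (a (rep (j f)))).
  rewrite subrK; lra.
apply: (le_trans (rad_pr_exists _)).
rewrite -mulrA [K%:R * _]mulr_natl -[X in _ <= _ *+ X]card_ord -sumr_const.
apply: ler_sum => d _.
have [[f [Ff fd]]|nof] := pselect (exists f, F f /\ j f = d); last first.
  rewrite rad_pr0; last by move=> x [].
  by rewrite ltW ?divr_gt0 ?mulr_gt0 ?exprn_gt0.
apply: (@le_trans _ _ (rad_pr (fun x => n%:R * c < `|rad_sum x (a (rep d))|))).
  by apply: le_rad_pr => x [].
have [Fr _] := repP _ Ff; rewrite -fd.
apply: (@le_trans _ _ (16 * (n%:R * M ^+ 2) / (n%:R * c) ^+ 2)).
  apply: rad_chebyshev; rewrite ?mulr_gt0 ?exprn_gt0//.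
  rewrite mulr_natl -[X in _ *+ X](card_ord n) -sumr_const.
  apply: ler_sum => i _; rewrite -real_normK ?num_real//.
  by rewrite lerXn2r ?nnegrE ?aM// ltW.
rewrite le_eqVlt; apply/orP; left; apply/eqP.
by field; rewrite !lt0r_neq0.
Qed.

End Equicontinuity.

(** * Laws of i.i.d. tuples *)

Section MeasurePreliminaries.
Context {R : realType}.

Definition mfunT d1 d2 (T1 : measurableType d1) (T2 : measurableType d2)
    (f : T1 -> T2) (mf : measurable_fun setT f) : {mfun T1 >-> T2} :=
  HB.pack f (isMeasurableFun.Build _ _ _ _ _ mf).

Definition cylinder (U : Type) n (A : 'I_n -> set U) : set (n.-tuple U) :=
  [set v | forall i, A i (tnth v i)].

Lemma cylinderE (U : Type) n (A : 'I_n -> set U) :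
  cylinder A = \bigcap_(i in setT) ((@tnth n U ^~ i) @^-1` A i).
Proof. by apply/seteqP; split => v vA i; [move=> _; exact: vA|exact: vA]. Qed.

Lemma measurable_cylinder d (U : measurableType d) n (A : 'I_n -> set U) :
  (forall i, measurable (A i)) -> measurable (cylinder A).
Proof.
move=> mA; rewrite cylinderE; apply: fin_bigcap_measurable => // i _.
by rewrite -[X in measurable X]setTI; exact: measurable_tnth.
Qed.

Definition cylinders d (U : measurableType d) n : set (set (n.-tuple U)) :=
  [set cylinder A | A in [set A : 'I_n -> set U | forall i, measurable (A i)]].

Lemma cylinders_generate d (U : measurableType d) n :
  measurable = <<s @cylinders d U n >>.
Proof.
apply/seteqP; split; last first.
  apply: smallest_sub; first exact: sigma_algebra_measurable.
  by move=> _ [A mA <-]; exact: measurable_cylinder.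
apply: smallest_sub; first exact: smallest_sigma_algebra.
rewrite -bigcup_seq => X [/= i _ [B mB <-]].
apply: sub_sigma_algebra.
exists (fun k => if k == i then B else setT) => [k|]; first by case: ifP.
rewrite setTI; apply/seteqP; split => v /=.
  by move/(_ i); rewrite eqxx.
by move=> Bv k; case: eqP => // ->.
Qed.

Lemma cylinders_setI_closed d (U : measurableType d) n : setI_closed (@cylinders d U n).
Proof.
move=> _ _ [A mA <-] [B mB <-]; exists (fun i => A i `&` B i) => [i|].
  exact: measurableI.
apply/seteqP; split => v; first by move=> h; split => i; case: (h i).
by move=> [h1 h2] i; split.
Qed.

Lemma cylinder_setT (U : Type) n : @cylinder U n (fun=> setT) = setT.
Proof. exact/seteqP. Qed.

(** Uniqueness on the pi-system of cylinders, for the restriction of [m] to [D] pushed forward by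
    [phi] and a multiple of [nu]. The free [D] and [c] allow a product law to be identified one
    factor at a time. *)
Lemma cylinder_unique d d' (X : measurableType d) (U : measurableType d') n
    (m : probability X R) (phi : X -> n.-tuple U) (D : set X) (c : \bar R)
    (nu : probability (n.-tuple U) R) :
  measurable_fun setT phi -> measurable D -> (0 <= c)%E -> c \is a fin_num ->
  (forall A, (forall i, measurable (A i)) ->
    m (D `&` phi @^-1` cylinder A) = c * nu (cylinder A))%E ->
  forall B, measurable B -> (m (D `&` phi @^-1` B) = c * nu B)%E.
Proof.
move=> mphi mD c0 cfin mA B mB.
have cE : c = (NngNum (fine_ge0 c0))%:num%:E by rewrite /= fineK.
rewrite setIC cE; apply: (@measure_unique _ R _ (@cylinders _ U n) (fun=> setT) _ _ _ _
  (measure_function_pushforward__canonical__measure_function_Measure (mrestr m mD) mphi)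
  (mscale (NngNum (fine_ge0 c0)) nu)) => //.
- exact: cylinders_generate.
- exact: cylinders_setI_closed.
- by move=> _; exists (fun=> setT) => //; exact: cylinder_setT.
- by rewrite bigcup_const.
- by move=> _ [A hA <-] /=; rewrite /pushforward /mrestr setIC mA// /mscale -cE.
- move=> _; rewrite /= /pushforward /mrestr preimage_setT setTI.
  by rewrite (le_lt_trans (probability_le1 _ _))// ltry.
Qed.

Definition iid_tuple d (U : measurableType d) (PU : probability U R) n
    (nu : probability (n.-tuple U) R) :=
  forall A : 'I_n -> set U, (forall i, measurable (A i)) ->
    (nu (cylinder A) = \prod_(i < n) PU (A i))%E.

Lemma product_cylinder_unique d d' (X : measurableType d) (U : measurableType d') n
    (P : probability X R) (nu : probability (n.-tuple U) R)
    (m : probability (X * n.-tuple U)%type R) :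
  (forall C A, measurable C -> (forall i, measurable (A i)) ->
    m (C `*` cylinder A) = P C * nu (cylinder A))%E ->
  forall Y, measurable Y -> ((P \x nu) Y = m Y)%E.
Proof.
move=> mP; apply: product_measure_unique => C B mC mB.
have setXE E F : E `*` F = (@fst X (n.-tuple U) @^-1` E) `&` (snd @^-1` F) by [].
rewrite setXE; apply: cylinder_unique => //.
- by rewrite -[X in measurable X]setTI; exact: measurable_fst.
- exact: fin_num_measure.
- by move=> A mA; rewrite -mP// setXE.
Qed.

End MeasurePreliminaries.

Section IidTuples.
Context {R : realType} {d : measure_display} {U : measurableType d}.
Variables (PU : probability U R) (n : nat) (nu : probability (n.-tuple U) R).
Hypothesis nuPU : iid_tuple PU nu.

Definition swap_tuples (s : {ffun 'I_n -> bool}) (z : n.-tuple U * n.-tuple U) :=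
  ([tuple if s i then tnth z.2 i else tnth z.1 i | i < n],
   [tuple if s i then tnth z.1 i else tnth z.2 i | i < n]).

Lemma measurable_swap_tuples s : measurable_fun setT (swap_tuples s).
Proof.
have m1 i := measurableT_comp (measurable_tnth i)
  (@measurable_fst _ _ (n.-tuple U) (n.-tuple U)).
have m2 i := measurableT_comp (measurable_tnth i)
  (@measurable_snd _ _ (n.-tuple U) (n.-tuple U)).
apply: measurable_fun_pair; apply/measurable_fun_tnthP => i.
  rewrite (_ : _ \o _ = fun z => if s i then tnth z.2 i else tnth z.1 i).
    by case: (s i); [exact: m2|exact: m1].
  by apply/funext => z /=; rewrite tnth_mktuple.
rewrite (_ : _ \o _ = fun z => if s i then tnth z.1 i else tnth z.2 i).
  by case: (s i); [exact: m1|exact: m2].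
by apply/funext => z /=; rewrite tnth_mktuple.
Qed.

(** On a product of two cylinders the exchange permutes the factors [PU (A i)] and [PU (B i)], which
    leaves their product unchanged; cylinders in each factor determine the measure. *)
Lemma swap_tuplesP s (Y : set (n.-tuple U * n.-tuple U)) : measurable Y ->
  ((nu \x nu) (swap_tuples s @^-1` Y) = (nu \x nu) Y)%E.
Proof.
move=> mY.
pose m := distribution (nu \x nu)%E (mfunT (measurable_swap_tuples s)).
suff h : forall Y, measurable Y -> ((nu \x nu) Y = m Y)%E by rewrite [RHS]h.
apply: product_cylinder_unique => C A mC mA.
have setXE E F : E `*` F = (@snd (n.-tuple U) (n.-tuple U) @^-1` F) `&` (fst @^-1` E).
  by rewrite setIC.
rewrite setXE muleC.
apply: (@cylinder_unique _ _ _ _ _ _ m (@fst (n.-tuple U) (n.-tuple U)) (snd @^-1` cylinder A)) => //.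
- rewrite -[X in measurable X]setTI; apply: (measurable_snd measurableT).
  exact: measurable_cylinder.
- by apply: fin_num_measure; exact: measurable_cylinder.
move=> B mB; rewrite -setXE /m /= /distribution /= /pushforward /=.
have -> : swap_tuples s @^-1` (cylinder B `*` cylinder A) =
    cylinder (fun i => if s i then A i else B i) `*`
    cylinder (fun i => if s i then B i else A i).
  apply/seteqP; split => -[x y] /=.
    move=> [h1 h2]; split => i; have := h1 i; have := h2 i;
    by rewrite !tnth_mktuple/=; case: (s i).
  move=> [h1 h2]; split => i; have := h1 i; have := h2 i;
  by rewrite !tnth_mktuple/=; case: (s i).
have mAB (i : 'I_n) : measurable (if s i then A i else B i) by case: (s i).
have mBA (i : 'I_n) : measurable (if s i then B i else A i) by case: (s i).
rewrite product_measure1E; [|exact: measurable_cylinder..].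
apply: (etrans (f_equal2 mule (nuPU mAB) (nuPU mBA))).
rewrite (nuPU mA) (nuPU mB) -!big_split/=; apply: eq_bigr => i _.
by case: (s i); rewrite // muleC.
Qed.

Lemma tuple_coordinate i (A : set U) : measurable A ->
  nu ((@tnth n U ^~ i) @^-1` A) = PU A.
Proof.
move=> mA.
have -> : (@tnth n U ^~ i) @^-1` A = cylinder (fun k => if k == i then A else setT).
  apply/seteqP; split => v /=; last by move/(_ i); rewrite eqxx.
  by move=> vA k; case: eqP => // ->.
rewrite nuPU; last by move=> k; case: ifP.
rewrite (bigD1 i)//= eqxx big1 ?mule1// => k /negbTE ->.
exact: probability_setT.
Qed.

Lemma tuple_coordinate_pair i j : i != j -> forall Y, measurable Y ->
  ((PU \x PU) Y = nu ((fun v => (tnth v i, tnth v j)) @^-1` Y))%E.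
Proof.
move=> ij.
have mf : measurable_fun setT (fun v : n.-tuple U => (tnth v i, tnth v j)).
  by apply: measurable_fun_pair; exact: measurable_tnth.
apply: (@product_measure_unique _ _ _ _ _ PU PU (distribution nu (mfunT mf))) => A B mA mB.
rewrite /= /distribution /= /pushforward.
have -> : mfunT mf @^-1` (A `*` B) =
   cylinder (fun k => if k == i then A else if k == j then B else setT).
  apply/seteqP; split => v /=; last first.
    by move=> h; have := h i; have := h j; rewrite !eqxx eq_sym (negbTE ij).
  by move=> [vA vB] k; case: eqP => [->//|_]; case: eqP => // ->.
rewrite nuPU; last by move=> k; do 2 case: ifP => //.
rewrite (bigD1 i)//= eqxx (bigD1 j)/=; last by rewrite eq_sym.
rewrite eqxx eq_sym (negbTE ij) big1 ?mule1// => k /andP[/negbTE -> /negbTE ->].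
exact: probability_setT.
Qed.

End IidTuples.

(** * Second moments of i.i.d. sums *)

Section Chebyshev.
Context {R : realType} {d : measure_display} {U : measurableType d}.

Lemma bounded_integrable d' (X : measurableType d') (P : probability X R) (f : X -> R) (M : R) :
  measurable_fun setT f -> (forall x, `|f x| <= M) -> P.-integrable setT (EFin \o f).
Proof.
move=> mf fM; apply: measurable_bounded_integrable => //.
  by rewrite (le_lt_trans (probability_le1 _ _))// ltry.
exists M; split; first exact: num_real.
by move=> y My x _; exact: le_trans (fM x) (ltW My).
Qed.

Variables (PU : probability U R) (n : nat) (nu : probability (n.-tuple U) R).
Hypothesis nuPU : iid_tuple PU nu.

Lemma integral_tuple_coordinate (k : U -> R) (M : R) i :
  measurable_fun setT k -> (forall x, `|k x| <= M) ->
  (\int[nu]_v (k (tnth v i))%:E = \int[PU]_x (k x)%:E)%E.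
Proof.
move=> mk kM.
have mt : measurable_fun setT (fun v : n.-tuple U => tnth v i) by exact: measurable_tnth.
have := @integral_distribution _ _ _ _ _ nu (mfunT mt) (EFin \o k).
move=> /(_ _ _)/= <-.
- by apply: eq_measure_integral => A mA _; exact: tuple_coordinate.
- exact/measurable_EFinP.
- exact: (@bounded_integrable _ _ _ (fun v : n.-tuple U => k (tnth v i)) M
    (measurableT_comp mk mt)).
Qed.

Lemma integral_tuple_coordinate_pair (k : U -> R) (M : R) i j : i != j ->
  measurable_fun setT k -> (forall x, `|k x| <= M) ->
  (\int[PU]_x (k x)%:E = 0)%E ->
  (\int[nu]_v (k (tnth v i) * k (tnth v j))%:E = 0)%E.
Proof.
move=> ij mk kM k0.
have mt : measurable_fun setT (fun v : n.-tuple U => (tnth v i, tnth v j)).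
  by apply: measurable_fun_pair; exact: measurable_tnth.
have mkk : measurable_fun setT (fun z : U * U => k z.1 * k z.2).
  by apply: measurable_funM; apply: measurableT_comp.
have M0 x : 0 <= M := le_trans (normr_ge0 (k x)) (kM x).
have kkM (z : U * U) : `|k z.1 * k z.2| <= M * M.
  by rewrite normrM ler_pM.
transitivity (\int[PU \x PU]_z (k z.1 * k z.2)%:E)%E.
  have := @integral_distribution _ _ _ _ _ nu (mfunT mt) (EFin \o (fun z => k z.1 * k z.2)).
  move=> /(_ _ _)/= <-.
  - apply: eq_measure_integral => A mA _; apply/esym.
    exact: (tuple_coordinate_pair nuPU ij mA).
  - exact/measurable_EFinP.
  - exact: (bounded_integrable nu (measurableT_comp mkk mt) (fun v => kkM _)).
rewrite -integral12_prod_meas1.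
  rewrite /fubini_F /=; apply: integral0_eq => x _.
  under eq_integral do rewrite EFinM.
  rewrite integralZl//; first by rewrite k0 mule0.
  exact: bounded_integrable mk kM.
exact: (@bounded_integrable _ _ _ (fun z => k z.1 * k z.2) (M * M)).
Qed.

Lemma measurable_sum_deviation (k : U -> R) (c s : R) : measurable_fun setT k ->
  measurable [set v : n.-tuple U | `|\sum_(i < n) k (tnth v i) - c| <= s].
Proof.
move=> mk; pose S (v : n.-tuple U) := \sum_(i < n) k (tnth v i) - c.
have mS : measurable_fun setT S.
  apply: measurable_funB => //; apply: measurable_sum => i.
  by apply: measurableT_comp => //; exact: measurable_tnth.
rewrite -[X in measurable X]setTI.
have := measurableT_comp (@normr_measurable R setT) mS.
move=> /(_ measurableT `]-oo, s]%classic); apply.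
exact: measurable_itv.
Qed.

(** Distinct coordinates are independent, so the cross terms integrate to 0 and the second moment is
    [n] times the variance. The probability one half is what a ghost sample must provide to be
    compared with the original one. *)
Lemma iid_chebyshev (k : U -> R) (M s : R) :
  measurable_fun setT k -> (forall x, `|k x| <= M) -> 0 < s ->
  n%:R * (\int[PU]_x (k x - \int[PU]_y k y) ^+ 2) <= s ^+ 2 / 2 ->
  (2^-1%:E <= nu [set v | `|\sum_(i < n) k (tnth v i) - n%:R * \int[PU]_y k y| <= s]%R)%E.
Proof.
move=> mk kM s0 var; set mu := (\int[PU]_y k y) in var *.
pose k0 x := k x - mu.
have mk0 : measurable_fun setT k0 by apply: measurable_funB.
have k0M x : `|k0 x| <= M + `|mu| by apply: (le_trans (ler_normB _ _)); rewrite lerD2r.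
have intk := bounded_integrable PU mk kM.
have k00 : (\int[PU]_x (k0 x)%:E = 0)%E.
  under eq_integral do rewrite /k0 EFinB.
  rewrite integralB//; last by exact: (@bounded_integrable _ _ _ (cst mu) `|mu|).
  rewrite integral_cst//=  probability_setT mule1 /mu /Rintegral fineK ?subee//;
    exact: integrable_fin_num.
have sqM x : `|k0 x ^+ 2| <= (M + `|mu|) ^+ 2.
  by rewrite normrX lerXn2r ?nnegrE// (le_trans _ (k0M x)).
have msq : measurable_fun setT (fun x => k0 x ^+ 2) by exact: measurable_funX.
have intsq := bounded_integrable PU msq sqM.
pose S (v : n.-tuple U) := \sum_(i < n) k0 (tnth v i).
have mt (i : 'I_n) : measurable_fun setT (fun v : n.-tuple U => k0 (tnth v i)).
  by apply: measurableT_comp => //; exact: measurable_tnth.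
have mS : measurable_fun setT S by exact: measurable_sum.
have SE (v : n.-tuple U) : \sum_(i < n) k (tnth v i) - n%:R * mu = S v.
  by rewrite /S /k0 sumrB sumr_const card_ord -[mu *+ _]mulr_natl.
have intkk (i j : 'I_n) : nu.-integrable setT
    (EFin \o (fun v : n.-tuple U => k0 (tnth v i) * k0 (tnth v j))).
  apply: (@bounded_integrable _ _ _ _ ((M + `|mu|) ^+ 2)).
    exact: measurable_funM.
  by move=> v; rewrite normrM expr2 ler_pM.
have ES : (\int[nu]_v ((S v) ^+ 2)%:E = (n%:R * \int[PU]_x (k0 x) ^+ 2)%:E)%E.
  have -> : (\int[nu]_v ((S v) ^+ 2)%:E =
      \int[nu]_v \sum_(i < n) \sum_(j < n) (k0 (tnth v i) * k0 (tnth v j))%:E)%E.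
    apply: eq_integral => v _; rewrite expr2 /S mulr_suml -sumEFin.
    by apply: eq_bigr => i _; rewrite mulr_sumr -sumEFin.
  rewrite integral_sum//; last first.
    by move=> i; apply: integrable_sum => // j _; exact: intkk.
  rewrite (eq_bigr (fun=> (\int[PU]_x (k0 x) ^+ 2)%:E)).
    by rewrite sumEFin sumr_const card_ord -[_ *+ n]mulr_natl.
  move=> i _; rewrite integral_sum//; last by move=> j; exact: intkk.
  rewrite (bigD1 i)//= big1 ?adde0; last first.
    move=> j ji; apply: (integral_tuple_coordinate_pair _ mk0 k0M k00).
    by rewrite eq_sym.
  rewrite /Rintegral fineK; last exact: integrable_fin_num.
  rewrite -(integral_tuple_coordinate i msq sqM).
  by apply: eq_integral.
have mSle : measurable [set v | `|S v| <= s].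
  have := measurable_sum_deviation (n%:R * mu) s mk.
  by under eq_set do rewrite SE.
under eq_set do rewrite SE.
have -> : [set v | `|S v| <= s] = ~` (~` [set v | `|S v| <= s]) by rewrite setCK.
rewrite probability_setC; last exact: measurableC.
have : ((s ^+ 2)%:E * nu (~` [set v | (`|S v| <= s)%R]) <= (s ^+ 2 / 2)%:E)%E.
  apply: (@le_trans _ _ (\int[nu]_v `|((S v) ^+ 2)%:E|)%E).
    apply: le_trans; last apply: (@le_integral_abse _ _ _ nu setT measurableT _ (s ^+ 2)).
    - apply: lee_pmul => //; first by rewrite lee_fin sqr_ge0.
      apply: le_measure.
      + by rewrite inE; exact: measurableC.
      + rewrite inE; apply: emeasurable_fun_c_infty => //.
        by apply: measurableT_comp => //; apply/measurable_EFinP; exact: measurable_funX.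
      + move=> v /= /negP; rewrite -ltNge => sv; split => //.
        rewrite lee_fin ger0_norm ?sqr_ge0// -[S v ^+ 2]real_normK ?num_real//.
        by rewrite lerXn2r ?nnegrE// ltW.
    - by apply/measurable_EFinP; exact: measurable_funX.
    - by rewrite exprn_gt0.
  under eq_integral => v _ do rewrite abse_EFin ger0_norm ?sqr_ge0//.
  by rewrite ES lee_fin.
set y := nu _.
have yfin : y \is a fin_num by apply: fin_num_measure; exact: measurableC.
rewrite -(fineK yfin) -EFinM -EFinB !lee_fin -ler_pdivlMl ?exprn_gt0// => ys.
have : (s ^+ 2)^-1 * (s ^+ 2 / 2) = 2^-1 :> R by rewrite mulKf// expf_neq0// gt_eqF.
lra.
Qed.

End Chebyshev.

(** * Symmetrization *)

Section Symmetrization.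
Context {R : realType} {dT dW dU : measure_display}.
Context {T : measurableType dT} {W : measurableType dW} {U : measurableType dU}.

(** Both inclusions matter: the first lets the measurable [M] stand in for the event in upper
    bounds, the second recovers the event from [M] outside a null set. *)
Lemma universally_measurable_cover {d} {X : measurableType d} (f : X -> \bar R)
    (mu : probability X R) (s : \bar R) : universally_measurable (R := R) f ->
  exists M N, [/\ measurable M, measurable N, mu N = 0%E,
    [set x | (s < f x)%E] `<=` M & M `<=` [set x | (s < f x)%E] `|` N].
Proof.
move=> /(_ mu)[g mg [N [mN N0 fg]]].
have mgs : measurable [set x | (s < g x)%E].
  by rewrite -[X in measurable X]setTI; exact: emeasurable_fun_o_infty.
exists ([set x | (s < g x)%E] `|` N), N; split => //.
- exact: measurableU.
- move=> x /= sf; have [fgx|fgx] := pselect (f x = g x); first by left; rewrite /= -fgx.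
  by right; exact: fg.
- move=> x [/= sg|]; last by right.
  have [fgx|fgx] := pselect (f x = g x); first by left; rewrite /= fgx.
  by right; exact: fg.
Qed.

(** Since all [A s] have measure [q], so has their average over signs. Interchanging this finite
    average with the integral makes [q] the integral of a Rademacher probability, at most [b] off
    [D] and at most 1 on it. *)
Lemma rad_pr_measure_le {d} {X : measurableType d} (mu : probability X R) n
    (A : {ffun 'I_n -> bool} -> set X) (D : set X) (b : R) (q : \bar R) :
  (forall s, measurable (A s)) -> measurable D -> 0 <= b ->
  (forall s, mu (A s) = q) ->
  (forall x, ~ D x -> rad_pr (fun s => A s x) <= b) ->
  (q <= b%:E + mu D)%E.
Proof.
move=> mA mD b0 Aq Ab.
have c0 : 0 <= 2^-1 ^+ n :> R by rewrite exprn_ge0.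
have w1 : \sum_(s : {ffun 'I_n -> bool}) 2^-1 ^+ n = 1 :> R.
  by have := @rad_mean_cst R n 1; rewrite /rad_mean mulr_sumr; under eq_bigr do rewrite mulr1.
have qE : q = (\int[mu]_x (rad_pr (fun s => A s x))%:E)%E.
  have -> : (\int[mu]_x (rad_pr (fun s => A s x))%:E =
      \int[mu]_x \sum_s ((2^-1 ^+ n)%:E * (\1_(A s) x)%:E))%E.
    apply: eq_integral => x _; rewrite /rad_pr /rad_mean mulr_sumr -sumEFin.
    apply: eq_bigr => s _; rewrite -EFinM indicE; congr (_ * _%:R)%:E.
  rewrite ge0_integral_sum//; last first.
    move=> s; apply: measurable_funeM; apply/measurable_EFinP.
    exact: measurable_indic.
  rewrite (eq_bigr (fun=> (2^-1 ^+ n)%:E * q)%E).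
    rewrite -[LHS]mul1e -ge0_sume_distrl; last by move=> s _; rewrite lee_fin.
    by rewrite sumEFin w1.
  move=> s _; rewrite ge0_integralZl//.
  - by rewrite integral_indic// setIT; congr (_ * _)%E; exact: Aq.
  - by apply/measurable_EFinP; exact: measurable_indic.
rewrite qE; apply: (@le_trans _ _ (\int[mu]_x (b%:E + (\1_D x)%:E))%E).
  apply: ge0_le_integral => //.
  - by move=> x _; rewrite lee_fin rad_pr_ge0.
  - apply/measurable_EFinP; rewrite /rad_pr /rad_mean.
    apply: measurable_funM => //; apply: measurable_sum => s.
    rewrite (_ : (fun x => _) = \1_(A s)); first exact: measurable_indic.
    apply/funext => x; rewrite indicE; congr _%:R.
  - by apply: emeasurable_funD => //; apply/measurable_EFinP; exact: measurable_indic.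
  - move=> x _; rewrite -EFinD lee_fin indicE.
    have [Dx|nDx] := pselect (D x).
      by rewrite mem_set//= (le_trans (rad_pr_le1 _))// lerDr.
    by rewrite memNset//= addr0 Ab.
rewrite ge0_integralD//.
- rewrite integral_indic// setIT integral_cst//=.
  by rewrite probability_setT mule1.
- by apply/measurable_EFinP; exact: measurable_indic.
Qed.

Variables (Pr : probability W R) (PU : probability U R) (n : nat).
Variables (nu : probability (n.-tuple U) R) (G : W -> {mfun U >-> T}).
Hypothesis nuPU : iid_tuple PU nu.
Hypothesis mG : measurable_fun setT (fun wu : W * U => G wu.1 wu.2).

Notation V := (n.-tuple U).

Definition swap_ghost (s : {ffun 'I_n -> bool}) (z : (W * V) * V) : (W * V) * V :=
  ((z.1.1, (swap_tuples s (z.1.2, z.2)).1), (swap_tuples s (z.1.2, z.2)).2).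

Lemma measurable_swap_ghost s : measurable_fun setT (swap_ghost s).
Proof.
have mz : measurable_fun setT (fun z : (W * V) * V => (z.1.2, z.2)).
  by apply: measurable_fun_pair => //; apply: measurableT_comp.
have ms := measurableT_comp (measurable_swap_tuples s) mz.
apply: measurable_fun_pair; last exact: measurableT_comp ms.
apply: measurable_fun_pair; last exact: measurableT_comp ms.
exact: measurableT_comp.
Qed.

Lemma ghost_measureE (Y : set ((W * V) * V)) : measurable Y ->
  (((Pr \x nu) \x nu) Y =
   \int[Pr]_w (nu \x nu) ((fun z => ((w, z.1), z.2)) @^-1` Y))%E.
Proof.
move=> mY; rewrite {1}/product_measure1.
rewrite (@fubini_tonelli1 _ _ _ _ _ Pr nu); last 2 first.
- exact: measurable_fun_xsection.
- by [].
apply: eq_integral => w _; rewrite /fubini_F/= /product_measure1.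
apply: eq_integral => v _ /=; congr (nu _).
Qed.

Lemma swap_ghostP s (Y : set ((W * V) * V)) : measurable Y ->
  (((Pr \x nu) \x nu) (swap_ghost s @^-1` Y) = ((Pr \x nu) \x nu) Y)%E.
Proof.
move=> mY; rewrite !ghost_measureE//; last first.
  by rewrite -[X in measurable X]setTI; exact: measurable_swap_ghost.
apply: eq_integral => w _.
have mw : measurable_fun setT (fun z : V * V => ((w, z.1), z.2)).
  by apply: measurable_fun_pair => //; apply: measurable_fun_pair.
rewrite -[RHS](swap_tuplesP nuPU s)//.
by rewrite -[X in measurable X]setTI; exact: mw.
Qed.

(** The two samples form a single tuple in [T] so that, with the weights [pooled_sign],
    [measurable_class] applies verbatim to the difference of the two sums. *)
Definition pooled_sample (z : (W * V) * V) : (n + n).-tuple T :=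
  [tuple match fintype.split i with
         | inl k => G z.1.1 (tnth z.1.2 k)
         | inr k => G z.1.1 (tnth z.2 k)
         end | i < n + n].

Lemma measurable_pooled_sample : measurable_fun setT pooled_sample.
Proof.
apply/measurable_fun_tnthP => i.
rewrite (_ : _ \o _ = fun z => match fintype.split i with
         | inl k => G z.1.1 (tnth z.1.2 k)
         | inr k => G z.1.1 (tnth z.2 k)
         end); last by apply/funext => z /=; rewrite tnth_mktuple.
case: (fintype.split i) => k.
- have mz : measurable_fun setT (fun z : (W * V) * V => (z.1.1, tnth z.1.2 k)).
    apply: measurable_fun_pair; first exact: measurableT_comp.
    by apply: (measurableT_comp (measurable_tnth k)); exact: measurableT_comp.
  exact: (measurableT_comp mG mz).
- have mz : measurable_fun setT (fun z : (W * V) * V => (z.1.1, tnth z.2 k)).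
    apply: measurable_fun_pair; first exact: measurableT_comp.
    exact: (measurableT_comp (measurable_tnth k)).
  exact: (measurableT_comp mG mz).
Qed.

Definition pooled_sign (i : 'I_(n + n)) : R := if fintype.split i is inl _ then 1 else -1.

Lemma pooled_sum_swap (h : T -> R) s w v v' :
  \sum_(i < n + n) pooled_sign i *
      h (tnth (pooled_sample (swap_ghost s ((w, v), v'))) i) =
  rad_sum s (fun i => h (G w (tnth v i)) - h (G w (tnth v' i))).
Proof.
rewrite big_split_ord/= -big_split/=; apply: eq_bigr => i _.
rewrite /pooled_sign !tnth_mktuple.
have -> : fintype.split (lshift n i) = inl i by exact: (unsplitK (inl i)).
have -> : fintype.split (rshift n i) = inr i by exact: (unsplitK (inr i)).
rewrite /= !tnth_mktuple mul1r mulN1r.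
by case: (s i); rewrite /= ?expr1 ?expr0 ?mul1r// mulN1r opprB.
Qed.

Lemma swap_ghost0 z : swap_ghost [ffun=> false] z = z.
Proof.
case: z => -[w v] v'; rewrite /swap_ghost /=.
by congr (_, _, _); apply: eq_from_tnth => i; rewrite tnth_mktuple ffunE.
Qed.

(* D collects the samples on which the conditional Rademacher bound may fail. *)
Lemma symmetrization (H : set (T -> R)) (C : set W) (D : set ((W * V) * V)) (M s b : R) :
  measurable_class H ->
  (forall h, H h -> measurable_fun setT h /\ forall x, `|h x| <= M) ->
  0 < s -> 0 <= b -> measurable D ->
  (forall w h, C w -> H h ->
    n%:R * (\int[PU]_u (h (G w u) - \int[PU]_u' h (G w u')) ^+ 2) <= s ^+ 2 / 8) ->
  (forall w v v', ~ D ((w, v), v') ->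
    rad_pr (fun e => exists h, H h /\ s / 2 <
      `|rad_sum e (fun i => h (G w (tnth v i)) - h (G w (tnth v' i)))|) <= b) ->
  exists E, [/\ measurable E,
    forall w v h, C w -> H h ->
      s < `|\sum_(i < n) h (G w (tnth v i)) - n%:R * \int[PU]_u h (G w u)| -> E (w, v) &
    ((Pr \x nu) E <= 2%:E * (b%:E + ((Pr \x nu) \x nu) D))%E].
Proof.
move=> mH Hb s0 b0 mD var hD.
(* Universal measurability is used for this one law, the mixture over [w] of the laws of the [n + n]
   points. *)
pose mu := distribution ((Pr \x nu) \x nu)%E (mfunT measurable_pooled_sample).
have [K [N [mK mN N0 sK Ks]]] := universally_measurable_cover mu (s / 2)%:E (mH _ pooled_sign).
have gtsup (x : (n + n).-tuple T) :
   ((s / 2)%:E < ereal_sup [set (`|\sum_(i < n + n) pooled_sign i * h (tnth x i)|)%:E | h in H])%E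
   <-> exists h, H h /\ s / 2 < `|\sum_(i < n + n) pooled_sign i * h (tnth x i)|.
  split=> [/ereal_sup_gt[_ [h Hh <-]]|[h [Hh sh]]].
    by rewrite lte_fin => sh; exists h.
  by rewrite -lte_fin in sh; apply: (lt_le_trans sh); apply: ereal_sup_ubound; exists h.
pose Y e := swap_ghost e @^-1` (pooled_sample @^-1` K).
have mpre (B : set ((n + n).-tuple T)) : measurable B -> measurable (pooled_sample @^-1` B).
  by move=> mB; rewrite -[X in measurable X]setTI; exact: measurable_pooled_sample.
have mswap e (B : set ((W * V) * V)) : measurable B -> measurable (swap_ghost e @^-1` B).
  by move=> mB; rewrite -[X in measurable X]setTI; exact: measurable_swap_ghost.
(* The null set is saturated under every exchange, because the Rademacher bound at one point looks
   at all its swapped copies. Invariance keeps each of the finitely many preimages null. *)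
pose N' := \bigcup_(e in [set: {ffun 'I_n -> bool}]) swap_ghost e @^-1` (pooled_sample @^-1` N).
have mN' : measurable N'.
  by apply: fin_bigcup_measurable => // e _; apply: mswap; exact: mpre.
have N'0 : (((Pr \x nu) \x nu) N' = 0)%E.
  apply/eqP; rewrite -measure_le0.
  apply: (le_trans (@content_sub_fsum _ _ _ _ _ [set: {ffun 'I_n -> bool}] N'
    (fun e => swap_ghost e @^-1` (pooled_sample @^-1` N)) finite_finset _ mN' (@subset_refl _ N'))).
    by move=> e _; apply: mswap; exact: mpre.
  by rewrite fsbig1// => e _; exact: (etrans (swap_ghostP e (mpre _ mN)) N0).
have Q : (((Pr \x nu) \x nu) (pooled_sample @^-1` K) <=
          b%:E + ((Pr \x nu) \x nu) (D `|` N'))%E.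
  apply: (@rad_pr_measure_le _ _ ((Pr \x nu) \x nu)%E n Y) => //.
  - by move=> e; apply: mswap; exact: mpre.
  - exact: measurableU.
  - by move=> e; apply: swap_ghostP; exact: mpre.
  move=> [[w v] v'] nDN; apply: (le_trans _ (hD w v v' _)); last first.
    by move=> Dz; apply: nDN; left.
  apply: le_rad_pr => e Ye.
  have [/gtsup[h [Hh]]|Nz] := Ks _ Ye.
    by rewrite pooled_sum_swap => sh; exists h.
  by exfalso; apply: nDN; right; exists e.
(* [F] is the probability, over the ghost sample alone, of landing in [K]. A large deviation of the
   first sample forces it to be at least one half, and Markov's inequality then costs the factor
   2. *)
pose F (z : W * V) := nu (xsection (pooled_sample @^-1` K) z).
have mF : measurable_fun setT F by apply: measurable_fun_xsection; exact: mpre.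
exists [set z | (2^-1%:E <= F z)%E]; split.
- by rewrite -[X in measurable X]setTI; exact: emeasurable_fun_c_infty.
- move=> w v h Cw Hh sh /=.
  have [mh hM] := Hb _ Hh.
  have mhG : measurable_fun setT (fun u => h (G w u)) by exact: measurableT_comp.
  have s20 : 0 < s / 2 by rewrite divr_gt0.
  (* The ghost sum deviates by at most [s / 2] with probability at least one half; where the
     original deviates by more than [s], the two sums differ by more than [s / 2]. *)
  have vw : n%:R * (\int[PU]_u (h (G w u) - \int[PU]_u' h (G w u')) ^+ 2) <= (s / 2) ^+ 2 / 2.
    by apply: (le_trans (var w h Cw Hh)); rewrite exprMn exprVn; lra.
  apply: (le_trans (iid_chebyshev nuPU mhG (fun u => hM _) s20 vw)).
  apply: le_measure; rewrite ?inE.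
  + exact: (measurable_sum_deviation _ _ mhG).
  + by apply: measurable_xsection; exact: mpre.
  move=> v' /= hv'; rewrite /xsection/= inE; apply: sK; apply/gtsup; exists h; split => //.
  rewrite -(swap_ghost0 (w, v, v')) pooled_sum_swap.
  rewrite (_ : rad_sum _ _ = \sum_(i < n) h (G w (tnth v i)) - \sum_(i < n) h (G w (tnth v' i))).
    move: sh hv'; set m := n%:R * _; rewrite ltr_normr ler_norml ltr_normr => /orP[] sh /andP[h1 h2].
      by apply/orP; left; lra.
    by apply/orP; right; lra.
  by rewrite -sumrB; apply: eq_bigr => i _; rewrite ffunE expr0 mul1r.
- have := @le_integral_abse _ _ _ (Pr \x nu)%E setT measurableT F 2^-1 mF.
  rewrite invr_gt0 ltr0n => /(_ isT) h.
  have {}h : (2^-1%:E * (Pr \x nu) [set z | (2^-1%:E <= F z)] <=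
      ((Pr \x nu) \x nu) (pooled_sample @^-1` K))%E.
    move: h; rewrite setTI.
    have -> : [set x | (2^-1%:E <= `|F x|)%E] = [set z | (2^-1%:E <= F z)%E].
      by apply/seteqP; split => z /=; rewrite gee0_abs.
    by under eq_integral do rewrite gee0_abs//.
  have {Q}Q := le_trans h Q.
  rewrite measureU0// in Q.
  by rewrite -lee_pdivrMl.
Qed.

End Symmetrization.

(** * Entropy numbers *)

Section Entropy.
Context {R : realType}.

(* Needed because the integrand of the entropy integral, a supremum over all
   laws, is not known to be measurable. *)
Lemma le_integral_unmeasurable d (X : measurableType d) (mu : {measure set X -> \bar R})
    (D : set X) (f g : X -> \bar R) :
  (forall x, D x -> 0 <= f x)%E -> (forall x, D x -> f x <= g x)%E ->
  (\int[mu]_(x in D) f x <= \int[mu]_(x in D) g x)%E.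
Proof.
move=> f0 fg; rewrite !ge0_integralE//; last first.
  by move=> x Dx; exact: le_trans (f0 x Dx) (fg x Dx).
apply: ge_ereal_sup => _ [h hf <-]; apply: ereal_sup_ubound; exists h => // x.
apply: (le_trans (hf x)); rewrite /patch; case: ifP => //; rewrite inE => Dx.
exact: fg.
Qed.

(** By monotonicity [phi] dominates the step function equal to [r k] on the interval from
    [2^-1 ^+ k.+1] to [2^-1 ^+ k]. The real sequence [r] only minorises [phi], so the bound is
    available before [phi] is known to be finite. *)
Lemma dyadic_sum_le_integral (phi : R -> \bar R) (r : nat -> R) (m : nat) :
  (forall x, 0 <= phi x)%E ->
  (forall x y, 0 < x -> x <= y -> (phi y <= phi x)%E) ->
  (forall k, 0 <= r k) -> (forall k, ((r k)%:E <= phi (2^-1 ^+ k)%R)%E) ->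
  ((\sum_(k < m) 2^-1 ^+ k.+1 * r k)%:E <=
   \int[lebesgue_measure]_(x in `]0%R, 1%R]) phi x)%E.
Proof.
move=> phi0 phia r0 rphi.
pose I k : set R := `]2^-1 ^+ k.+1, 2^-1 ^+ k]%classic.
have h0 k : 0 < 2^-1 ^+ k :> R by rewrite exprn_gt0.
have h1 k : 2^-1 ^+ k <= 1 :> R by rewrite exprn_ile1// invf_le1// ler1n.
have hle k l : (k <= l)%N -> 2^-1 ^+ l <= 2^-1 ^+ k :> R.
  by move=> kl; rewrite ler_wiXn2l// invf_le1// ler1n.
have mI k : measurable (I k) by exact: measurable_itv.
have lambdaI k : lebesgue_measure (I k) = (2^-1 ^+ k.+1)%:E.
  rewrite lebesgue_measure_itv/= lte_fin exprS ifT; last by have := h0 k; lra.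
  by rewrite -EFinB; congr EFin; have := h0 k; lra.
apply: (@le_trans _ _ (\int[lebesgue_measure]_(x in `]0%R, 1%R])
    (\sum_(k < m) (r k)%:E * (\1_(I k) x)%:E))%E).
  rewrite ge0_integral_sum//; last 2 first.
  - by move=> k; apply: measurable_funeM; apply/measurable_EFinP; have := @measurable_indic _ _ R setT _ (mI k); exact: measurable_funTS.
  - by move=> k x _; rewrite mule_ge0// lee_fin.
  rewrite -sumEFin; apply: lee_sum => k _.
  rewrite ge0_integralZl//; last 2 first.
  - by apply/measurable_EFinP; have := @measurable_indic _ _ R setT _ (mI k); exact: measurable_funTS.
  - by rewrite lee_fin.
  rewrite integral_indic; [|exact: measurable_itv|exact: mI].
  rewrite setIidl; last first.
    by move=> x; rewrite /I /= !in_itv/= => /andP[a b]; rewrite (lt_trans (h0 _) a)/= (le_trans b).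
  rewrite mulrC EFinM; apply: lee_wpmul2l; first by rewrite lee_fin.
  by rewrite -lambdaI.
apply: le_integral_unmeasurable => x.
  by move=> _; apply: sume_ge0 => k _; rewrite mule_ge0// lee_fin.
rewrite /= in_itv/= => /andP[x0 x1].
have [[k Ikx]|nI] := pselect (exists k : 'I_m, I k x); last first.
  rewrite big1//= => k _; rewrite indicE memNset ?mule0//.
  by move=> Ikx; apply: nI; exists k.
rewrite (bigD1 k)//= big1 ?adde0.
  rewrite indicE mem_set//= mule1; apply: (le_trans (rphi k)); apply: phia => //.
  by move: Ikx; rewrite /I/= in_itv/= => /andP[].
move=> l lk; rewrite indicE memNset ?mule0//.
move: Ikx; rewrite /I/= !in_itv/= => /andP[xk xk'] /andP[xl xl'].
have [kl|kl|/val_inj kl] := ltngtP k l.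
- have := hle _ _ kl; lra.
- have := hle _ _ kl; lra.
- by rewrite kl eqxx in lk.
Qed.

Context {d : measure_display} {T : measurableType d}.
Implicit Types (F : set (T -> R)) (L : probability T R).

Let root_entropy F B (eps : R) : \bar R :=
  ereal_sup [set sqrte (1 + lne (covering_number (eps%:E * L2norm L (cst B)) F L))%E
            | L in [set: probability T R]].

Lemma L2norm_cst (L : probability T R) (B : R) : 0 < B -> L2norm L (cst B) = B%:E.
Proof.
move=> B0; rewrite /L2norm unlock.
under eq_integral => x _ do rewrite /= ger0_norm ?ltW//.
rewrite integral_cst//= probability_setT mule1 poweR_EFin -powRrM mulfV// powRr1//.
exact: ltW.
Qed.

Lemma covering_number_ge0 r F L : (0 <= covering_number r F L)%E.
Proof. by apply: le_ereal_inf_tmp => _ [n _ <-]; rewrite lee_fin. Qed.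

Lemma le_covering_number r r' F L : (r <= r')%E ->
  (covering_number r' F L <= covering_number r F L)%E.
Proof.
move=> rr'; apply: le_ereal_inf => _ [n [c [cL cF]] <-]; exists n => //.
exists c; split=> // f Ff; have [i fi] := cF f Ff.
by exists i; exact: lt_le_trans fi rr'.
Qed.

Lemma le_sqrte (x y : \bar R) : (x <= y -> sqrte x <= sqrte y)%E.
Proof.
move=> xy; have [y0|y0] := leP 0%E y; first by rewrite lee_sqrt.
rewrite (_ : sqrte x = 0%E) ?sqrte_ge0//.
move: x y xy y0 => [x||] [y||]//=; rewrite lee_fin lte_fin => xy y0.
by rewrite ler0_sqrtr// (le_trans xy)// ltW.
Qed.

Lemma le_lne (x y : \bar R) : (0 <= x -> x <= y -> lne x <= lne y)%E.
Proof.
move=> x0 xy; rewrite lee_lne// in_itv/= leey ?andbT//.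
exact: le_trans xy.
Qed.

Lemma root_entropy_nincr F B x y : 0 < B -> 0 < x -> x <= y ->
  (root_entropy F B y <= root_entropy F B x)%E.
Proof.
move=> B0 x0 xy; apply: ge_ereal_sup => _ [L _ <-].
apply: (le_trans _ (ereal_sup_ubound _)); last by exists L.
apply: le_sqrte; apply: leeD => //; apply: le_lne; first exact: covering_number_ge0.
apply: le_covering_number; rewrite L2norm_cst// -!EFinM lee_fin ler_pM2r//.
Qed.

Lemma covering_number_attained r F L : covering_number r F L != +oo%E ->
  exists n, covering_number r F L = n%:R%:E /\
    exists c : 'I_n -> T -> R,
      (forall i, measurable_fun setT (c i) /\ (L2norm L (c i) < +oo)%E) /\
      (forall f, F f -> exists i, (L2norm L (fun x => f x - c i x)%R < r)%E).
Proof.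
set cover := fun n => exists c : 'I_n -> T -> R,
      (forall i, measurable_fun setT (c i) /\ (L2norm L (c i) < +oo)%E) /\
      (forall f, F f -> exists i, (L2norm L (fun x => f x - c i x)%R < r)%E).
have [[n0 n0c] _|nc /eqP] := pselect (exists n, cover n); last first.
  rewrite /covering_number (_ : [set _ | _ in _] = set0) ?ereal_inf0//.
  by rewrite -subset0 => x [n nc' _]; apply: nc; exists n.
have exn : exists n, `[< cover n >] by exists n0; exact/asboolP.
case: (ex_minnP exn) => n /asboolP nc nmin; exists n; split => //.
apply/eqP; rewrite eq_le; apply/andP; split.
  by apply: ereal_inf_lbound; exists n.
apply: le_ereal_inf_tmp => _ [k kc <-]; rewrite lee_fin ler_nat; apply: nmin.
exact/asboolP.
Qed.

(** [e k] is the integrand of the entropy integral at [2^-1 ^+ k]. Being a supremum over laws, it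
    controls the covers for every [L] with the same bound; the lengths [2^-1 ^+ k.+1] of the dyadic
    intervals explain the factor 2 in [M]. *)
Lemma entropy_numbers (L0 : probability T R) F (B : R) : 0 < B -> F !=set0 ->
  (uniform_entropy_integral 1 F (cst B) < +oo)%E ->
  exists (e : nat -> R) (M : R), [/\ forall k, 0 <= e k,
    forall m, \sum_(0 <= k < m) 2^-1 ^+ k * e k <= M &
    forall L k, exists n, n%:R <= expR (e k ^+ 2) /\
      exists c : 'I_n -> T -> R, (forall i, measurable_fun setT (c i)) /\
      (forall f, F f -> exists i,
         (L2norm L (fun x => f x - c i x)%R < (2^-1 ^+ k * B)%:E)%E)].
Proof.
move=> B0 [f0 Ff0]; rewrite /uniform_entropy_integral.
set J := (\int[_]_(_ in _) _)%E => Joo.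
have h0 k : 0 < 2^-1 ^+ k :> R by rewrite exprn_gt0.
have phi0 x : (0 <= root_entropy F B x)%E.
  by apply: (le_trans (sqrte_ge0 _)); apply: ereal_sup_ubound; exists L0.
have phiJ (r : nat -> R) m : (forall k, 0 <= r k) ->
    (forall k, ((r k)%:E <= root_entropy F B (2^-1 ^+ k)%R)%E) ->
    ((\sum_(k < m) 2^-1 ^+ k.+1 * r k)%:E <= J)%E.
  move=> r0 rphi; apply: dyadic_sum_le_integral => // x y x0 xy.
  exact: root_entropy_nincr.
have J0 : (0 <= J)%E by apply: integral_ge0 => x _; exact: phi0.
have Jfin : J \is a fin_num by rewrite ge0_fin_numE.
have phifin k : root_entropy F B (2^-1 ^+ k) \is a fin_num.
  rewrite ge0_fin_numE// ltey; apply/eqP => phioo.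
  (* An infinite value at one scale would allow a test sequence concentrated there whose weighted
     sum is [fine J + 1]. *)
  pose x := (fine J + 1) / 2^-1 ^+ k.+1.
  have x0 : 0 <= x by apply: divr_ge0; [apply: addr_ge0 => //; exact: fine_ge0|exact: ltW].
  have := phiJ (fun i => if i == k then x else 0) k.+1.
  rewrite big_ord_recr/= eqxx big1 => [|i _]; last by rewrite (ltn_eqF (ltn_ord i)) mulr0.
  have kx : 2^-1 ^+ k.+1 * x = fine J + 1 by rewrite /x mulrC divfK ?gt_eqF.
  rewrite add0r kx.
  have -> : ((fine J + 1)%:E <= J)%E = false.
    by rewrite -[X in (_ <= X)%E](fineK Jfin) lee_fin; apply/negbTE; rewrite -ltNge ltrDl.
  move=> h; apply: notF; apply: h => i; first by case: ifP.
  by case: eqP => [->|_]; [rewrite phioo leey|exact: phi0].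
pose e k := fine (root_entropy F B (2^-1 ^+ k)).
have eE k : (e k)%:E = root_entropy F B (2^-1 ^+ k) by rewrite /e fineK.
exists e, (2 * fine J); split.
- by move=> k; exact: fine_ge0.
- move=> m; have := phiJ e m (fun k => fine_ge0 (phi0 _)).
  rewrite big_mkord -[J](fineK Jfin) lee_fin => h.
  have -> : \sum_(k < m) 2^-1 ^+ k * e k = 2 * \sum_(k < m) 2^-1 ^+ k.+1 * e k.
    by rewrite mulr_sumr; apply: eq_bigr => k _; rewrite exprS; field.
  by rewrite ler_pM2l//; apply: h => k; rewrite eE.
move=> L k.
have Le : (sqrte (1 + lne (covering_number ((2^-1 ^+ k)%:E * L2norm L (cst B)) F L)) <= (e k)%:E)%E.
  by rewrite eE; apply: ereal_sup_ubound; exists L.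
rewrite L2norm_cst// -EFinM in Le.
have [n [nE [c [cm cF]]]] : exists n, covering_number (2^-1 ^+ k * B)%:E F L = n%:R%:E /\
    exists c : 'I_n -> T -> R,
      (forall i, measurable_fun setT (c i) /\ (L2norm L (c i) < +oo)%E) /\
      (forall f, F f -> exists i, (L2norm L (fun x => f x - c i x)%R < (2^-1 ^+ k * B)%:E)%E).
  by apply: covering_number_attained; apply/eqP => Noo; rewrite Noo/= in Le.
exists n; split; last by exists c; split => // i; exact: (cm i).1.
(* A nonempty class needs at least one ball; this excludes the value of the logarithm at 0. *)
have n0 : (0 < n)%N by have [i _] := cF _ Ff0; case: n i {nE c cm cF Le} => // -[].
move: Le; rewrite nE lne_EFin ?ltr0n// -EFinD lee_fin => Le.
have n1 : (1 : R) <= n%:R by rewrite ler1n.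
have ln0 : 0 <= ln n%:R :> R by exact: ln_ge0.
rewrite -[n%:R]lnK ?posrE ?ltr0n// ler_expR.
have : Num.sqrt (1 + ln n%:R) ^+ 2 <= e k ^+ 2.
  by rewrite lerXn2r ?nnegrE ?sqrtr_ge0//; exact: fine_ge0.
rewrite sqr_sqrtr; lra.
Qed.

End Entropy.

(** * Covers at empirical measures *)

Section Empirical.
Context {R : realType} {d : measure_display} {T : measurableType d}.
Variables (m : nat) (x : 'I_m.+1 -> T).

Let weight_ge0 : 0 <= m.+1%:R^-1 :> R.
Proof. by rewrite invr_ge0. Qed.

Definition empirical_measure : set T -> \bar R :=
  mscale (NngNum weight_ge0) (msum (fun k => dirac (x (inord k))) m.+1).

HB.instance Definition _ := Measure.on empirical_measure.

Let empirical_setT : empirical_measure setT = 1%E.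
Proof.
rewrite /empirical_measure /mscale/= /msum (eq_bigr (fun=> 1%E)); last by move=> k _; exact: diracT.
by rewrite sumEFin sumr_const card_ord -EFinM mulVf// pnatr_eq0.
Qed.

HB.instance Definition _ := Measure_isProbability.Build _ _ _ empirical_measure empirical_setT.

Lemma L2norm_empirical (h : T -> R) (r : R) : measurable_fun setT h -> 0 <= r ->
  (L2norm empirical_measure h < r%:E)%E -> \sum_i h (x i) ^+ 2 <= m.+1%:R * r ^+ 2.
Proof.
move=> mh r0 hr.
have mh2 : measurable_fun setT (fun t => (h t ^+ 2)%:E).
  by apply/measurable_EFinP; exact: measurable_funX.
have intE : (\int[empirical_measure]_t (h t ^+ 2)%:E = (m.+1%:R^-1 * \sum_i h (x i) ^+ 2)%:E)%E.
  rewrite /empirical_measure ge0_integral_mscale//; last by move=> t _; rewrite lee_fin sqr_ge0.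
  rewrite ge0_integral_measure_sum//; last by move=> t _; rewrite lee_fin sqr_ge0.
  rewrite EFinM -sumEFin; congr (_ * _)%E; apply: eq_bigr => i _.
  by rewrite integral_dirac// diracT mul1e inord_val.
have : (L2norm empirical_measure h `^ 2 <= (r%:E) `^ 2)%E.
  by apply: gt0_ler_poweR; rewrite ?in_itv/= ?leey ?Lnorm_ge0 ?lee_fin ?r0 ?ltW.
rewrite /L2norm poweR_Lnorm//.
have -> : (\int[empirical_measure]_t `|(EFin \o h) t| `^ 2 =
           \int[empirical_measure]_t (h t ^+ 2)%:E)%E.
  by apply: eq_integral => t _; rewrite /= powR_mulrn ?normr_ge0// real_normK ?num_real.
rewrite intE poweR_EFin lee_fin powR_mulrn//.
by rewrite ler_pdivrMl.
Qed.

End Empirical.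

Section Cover.
Context {R : realType} {d : measure_display} {T : measurableType d}.

(** The cover for the empirical law of the sample, turned into a partition by assigning a centre to
    each function. Two functions with a common centre are compared through it, whence the 4. *)
Lemma empirical_partition (F : set (T -> R)) (f0 : T -> R) (e r : R) m (x : 'I_m -> T) :
  (0 < m)%N -> F f0 -> (forall f, F f -> measurable_fun setT f) -> 0 <= r ->
  (forall L : probability T R, exists n, n%:R <= e /\
      exists c : 'I_n -> T -> R, (forall i, measurable_fun setT (c i)) /\
      (forall f, F f -> exists i, (L2norm L (fun x => f x - c i x)%R < r%:E)%E)) ->
  exists n (j : (T -> R) -> 'I_n), n%:R <= e /\
    forall f g, F f -> F g -> j f = j g ->
      \sum_i (f (x i) - g (x i)) ^+ 2 <= 4 * (m%:R * r ^+ 2).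
Proof.
case: m x => // m x _ Ff0 mF r0 /(_ (empirical_measure x)) [n [ne [c [mc cF]]]].
have [i0 _] := cF _ Ff0.
have /choice[j jP] : forall f, exists i, F f ->
    (L2norm (empirical_measure x) (fun x => f x - c i x)%R < r%:E)%E.
  move=> f; have [Ff|nF] := pselect (F f); last by exists i0.
  by have [i fi] := cF f Ff; exists i.
exists n, j; split => // f g Ff Fg jfg.
apply: (@sum_sqrB_le _ _ _ _ (fun i => c (j f) (x i))).
- apply: (@L2norm_empirical _ _ _ _ _ (fun t => f t - c (j f) t)) => //; last exact: jP.
  by apply: measurable_funB => //; exact: mF.
- apply: (@L2norm_empirical _ _ _ _ _ (fun t => g t - c (j f) t)) => //; last first.
    by rewrite jfg; exact: jP.
  by apply: measurable_funB => //; exact: mF.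
Qed.

End Cover.

(** * Laws of large numbers *)

Section BoundedIntegrals.
Context {R : realType} {d : measure_display} {U : measurableType d} (P : probability U R).
Variables (k : U -> R) (M : R).
Hypotheses (mk : measurable_fun setT k) (kM : forall x, `|k x| <= M).

Lemma Rintegral_prob_cst (c : R) : \int[P]_x c = c.
Proof. by rewrite Rintegral_cst//= probability_setT mulr1. Qed.

Lemma Rintegral_bound : `|\int[P]_x k x| <= M.
Proof.
have ik := bounded_integrable P mk kM.
apply: (le_trans (le_normr_Rintegral _ ik)) => //.
rewrite -[leRHS]Rintegral_prob_cst; apply: le_Rintegral => //.
- by apply: (bounded_integrable P (measurableT_comp (@normr_measurable R setT) mk)) => x;
  rewrite /= normr_id.
- exact: (@bounded_integrable _ _ _ _ (fun=> M) `|M|).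
Qed.

Lemma variance_expand :
  \int[P]_x (k x - \int[P]_y k y) ^+ 2 = \int[P]_x k x ^+ 2 - (\int[P]_y k y) ^+ 2.
Proof.
set c := \int[P]_y k y.
have ik := bounded_integrable P mk kM.
have ik2 : P.-integrable setT (EFin \o (fun x => k x ^+ 2)).
  apply: (@bounded_integrable _ _ _ _ _ (M ^+ 2)); first exact: measurable_funX.
  by move=> x; rewrite normrX lerXn2r ?nnegrE// (le_trans _ (kM x)).
have ickc : P.-integrable setT (EFin \o (fun x => 2 * c * k x - c ^+ 2)).
  apply: (@bounded_integrable _ _ _ _ _ (2 * `|c| * M + `|c ^+ 2|)).
    by apply: measurable_funB => //; apply: measurable_funM.
  move=> x; apply: (le_trans (ler_normB _ _)); rewrite lerD2r !normrM [`|2|]ger0_norm//.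
  by rewrite ler_wpM2l// mulr_ge0.
have ick : P.-integrable setT (EFin \o (fun x => 2 * c * k x)).
  apply: (@bounded_integrable _ _ _ _ _ (2 * `|c| * M)).
    by apply: measurable_funM.
  by move=> x; rewrite !normrM [`|2|]ger0_norm// ler_wpM2l// mulr_ge0.
transitivity (\int[P]_x (k x ^+ 2 - (2 * c * k x - c ^+ 2))).
  by apply: eq_Rintegral => x _; ring.
rewrite RintegralB// RintegralB//; last first.
  exact: (@bounded_integrable _ _ _ _ (fun=> c ^+ 2) `|c ^+ 2|).
rewrite RintegralZl// -/c Rintegral_prob_cst; ring.
Qed.

Lemma variance_bound : \int[P]_x (k x - \int[P]_y k y) ^+ 2 <= M ^+ 2.
Proof.
have M0 x : 0 <= M := le_trans (normr_ge0 (k x)) (kM x).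
rewrite variance_expand.
rewrite lerBlDr ler_wpDr ?sqr_ge0//.
rewrite -[leRHS]Rintegral_prob_cst; apply: le_Rintegral => //.
- apply: (@bounded_integrable _ _ _ _ _ (M ^+ 2)); first exact: measurable_funX.
  by move=> x; rewrite normrX lerXn2r ?nnegrE// (M0 x).
- exact: (@bounded_integrable _ _ _ _ (fun=> M ^+ 2) `|M ^+ 2|).
- by move=> x _; rewrite -real_normK ?num_real// lerXn2r ?nnegrE// (M0 x).
Qed.

End BoundedIntegrals.

(** Expanding the square around [c] shows that each sample has centred sum of squares at most [n]
    times [t + k * (1 + 2 * A)]; the samples are then compared through their common mean [c]. This
    converts a small variance into a small empirical distance. *)
Lemma sum_sqr_difference_le {R : realType} n (p q : 'I_n -> R) (c m2 k t A : R) :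
  `|c| <= A -> 0 <= k -> m2 - c ^+ 2 <= t ->
  `|\sum_i p i - n%:R * c| <= n%:R * k -> `|\sum_i p i ^+ 2 - n%:R * m2| <= n%:R * k ->
  `|\sum_i q i - n%:R * c| <= n%:R * k -> `|\sum_i q i ^+ 2 - n%:R * m2| <= n%:R * k ->
  \sum_i (p i - q i) ^+ 2 <= n%:R * (4 * (t + k * (1 + 2 * A))).
Proof.
move=> cA k0 mt.
have centered (a : 'I_n -> R) : `|\sum_i a i - n%:R * c| <= n%:R * k ->
    `|\sum_i a i ^+ 2 - n%:R * m2| <= n%:R * k ->
    \sum_i (a i - c) ^+ 2 <= n%:R * (t + k * (1 + 2 * A)).
  move=> a1 a2.
  have -> : \sum_i (a i - c) ^+ 2 = \sum_i a i ^+ 2 - 2 * c * \sum_i a i + n%:R * c ^+ 2.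
    have -> : n%:R * c ^+ 2 = \sum_(i < n) c ^+ 2 by rewrite sumr_const card_ord mulr_natl.
    rewrite mulr_sumr -sumrB -big_split/=.
    by apply: eq_bigr => i _; ring.
  have h : `|c * (\sum_i a i - n%:R * c)| <= A * (n%:R * k) by rewrite normrM ler_pM.
  move: h a2; rewrite !ler_norml => /andP[h1 h2] /andP[h3 h4].
  have : n%:R * (m2 - c ^+ 2) <= n%:R * t by rewrite ler_wpM2l.
  lra.
move=> p1 p2 q1 q2.
rewrite [leRHS](_ : _ = 4 * (n%:R * (t + k * (1 + 2 * A)))); last by ring.
by apply: (@sum_sqrB_le _ _ _ _ (fun=> c)); exact: centered.
Qed.

Section UniformLLN.
Context {R : realType} {dT : measure_display} {T : measurableType dT}.

(** The threshold [n0] precedes the probability spaces, the laws and the generator: the bound is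
    meant for a triangular array in which all of these change with [n]. *)
Lemma uniform_lln (I : Type) (F : set I) (phi : I -> T -> R) (M k c : R) :
  0 < M -> 0 < k -> 0 < c ->
  measurable_class [set phi i | i in F] ->
  (forall i, F i -> measurable_fun setT (phi i) /\ forall x, `|phi i x| <= M) ->
  (forall r, 0 < r -> exists N : R, 0 <= N /\ forall n (x y : 'I_n -> T), (0 < n)%N ->
    exists K (j : I -> 'I_K), K%:R <= N /\ forall i i', F i -> F i' -> j i = j i' ->
      \sum_l `|phi i (x l) - phi i' (x l)| + \sum_l `|phi i (y l) - phi i' (y l)| <= n%:R * r) ->
  exists n0, forall n, (n0 <= n)%N -> (0 < n)%N ->
  forall (dW dU : measure_display) (W : measurableType dW) (U : measurableType dU)
    (Pr : probability W R) (PU : probability U R) (nu : probability (n.-tuple U) R)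
    (G : W -> {mfun U >-> T}),
  iid_tuple PU nu -> measurable_fun setT (fun wu : W * U => G wu.1 wu.2) ->
  exists E, [/\ measurable E,
    forall w v i, F i ->
      n%:R * k < `|\sum_(l < n) phi i (G w (tnth v l)) - n%:R * \int[PU]_u phi i (G w u)| ->
      E (w, v) &
    ((Pr \x nu) E <= c%:E)%E].
Proof.
move=> M0 k0 c0 mH bH cov.
have [N [N0 hN]] := cov (k / 4) (divr_gt0 k0 (ltr0n _ 4)).
pose A := N * (16 * (2 * M) ^+ 2 / (k / 4) ^+ 2).
have A0 : 0 <= A by rewrite mulr_ge0// divr_ge0 ?sqr_ge0// mulr_ge0// sqr_ge0.
(* The first bound gives the variance condition of [symmetrization] at level [n * k], the second
   makes twice the Rademacher bound [A / n] at most [c]. *)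
exists (maxn (Num.bound (8 * M ^+ 2 / k ^+ 2)) (Num.bound (2 * A / c))).
move=> n; rewrite geq_max => /andP[nM nA] n0 dW dU W U Pr PU nu G nuPU mG.
have n0' : 0 < n%:R :> R by rewrite ltr0n.
have nM' : 8 * M ^+ 2 <= n%:R * k ^+ 2.
  rewrite -ler_pdivrMr ?exprn_gt0//.
  apply: (@le_trans _ _ (Num.bound (8 * M ^+ 2 / k ^+ 2))%:R); last by rewrite ler_nat.
  by rewrite ltW// archi_boundP// divr_ge0 ?sqr_ge0// mulr_ge0// sqr_ge0.
have nA' : 2 * (A / n%:R) <= c.
  rewrite mulrA ler_pdivrMr// [c * _]mulrC -ler_pdivrMr//.
  apply: (@le_trans _ _ (Num.bound (2 * A / c))%:R); last by rewrite ler_nat.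
  by rewrite ltW// archi_boundP// divr_ge0 ?(ltW c0)// mulr_ge0.
have [//|//|//|||E [mE hE PE]] :=
  @symmetrization R _ _ _ T W U Pr PU n nu G nuPU mG
    [set phi i | i in F] setT set0 M (n%:R * k) (A / n%:R) mH _ _ _ measurable0.
- by move=> _ [i Fi <-]; exact: bH.
- by rewrite mulr_gt0.
- by rewrite divr_ge0// ltW.
- move=> w _ _ [i Fi <-]; have [mi Mi] := bH i Fi.
  have var := @variance_bound R _ U PU (fun u => phi i (G w u)) M
    (measurableT_comp mi (measurable_funP (G w))) (fun u => Mi _).
  apply: (@le_trans _ _ (n%:R * M ^+ 2)); first by rewrite ler_pM2l.
  have : n%:R * (8 * M ^+ 2) <= n%:R * (n%:R * k ^+ 2) by rewrite ler_pM2l.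
  rewrite exprMn; lra.
- move=> w v v' _.
  have [K [j [KN jP]]] := hN n (fun l => G w (tnth v l)) (fun l => G w (tnth v' l)) n0.
  apply: (@le_trans _ _ (rad_pr (fun e => exists i, F i /\ n%:R * (2 * (k / 4)) <
    `|rad_sum e (fun l => phi i (G w (tnth v l)) - phi i (G w (tnth v' l)))|))).
    apply: le_rad_pr => e [_ [[i Fi <-]] h]; exists i; split => //.
    by apply: le_lt_trans h; lra.
  apply: (le_trans (@rad_glivenko_cantelli R n K I F j _ (k / 4) (2 * M) n0 _ _ _ _)).
  - by rewrite divr_gt0.
  - by rewrite mulr_gt0.
  - move=> i i' Fi Fi' jii; apply: (le_trans _ (jP i i' Fi Fi' jii)).
    rewrite -big_split/=; apply: ler_sum => l _.
    rewrite [X in `|X|](_ : _ = (phi i (G w (tnth v l)) - phi i' (G w (tnth v l))) -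
      (phi i (G w (tnth v' l)) - phi i' (G w (tnth v' l)))); last by ring.
    exact: ler_normB.
  - move=> i l Fi; have [_ Mi] := bH i Fi.
    by apply: (le_trans (ler_normB _ _)); rewrite mulr_natl mulr2n lerD.
  rewrite ler_pM2r ?invr_gt0// ler_wpM2r//.
  by rewrite divr_ge0 ?sqr_ge0// mulr_ge0// sqr_ge0.
exists E; split => //.
- by move=> w v i Fi h; apply: hE h => //; exists i.
- by apply: (le_trans PE); rewrite measure0 adde0 -EFinM lee_fin.
Qed.

End UniformLLN.

(** * Laws of large numbers for differences and their squares *)

Section BootstrapEquicontinuity.
Context {R : realType} {dT : measure_display} {T : measurableType dT}.
Variables (F : set (T -> R)) (f0 : T -> R) (B M : R) (e : nat -> R).
Hypotheses (B0 : 0 < B) (Ff0 : F f0) (mF : forall f, F f -> measurable_fun setT f).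
Hypothesis FB : forall f x, F f -> `|f x| <= B.
Hypotheses (e0 : forall k, 0 <= e k)
  (eM : forall m, \sum_(0 <= k < m) 2^-1 ^+ k * e k <= M).
Hypothesis cover : forall (L : probability T R) k, exists n, n%:R <= expR (e k ^+ 2) /\
  exists c : 'I_n -> T -> R, (forall i, measurable_fun setT (c i)) /\
  (forall f, F f -> exists i,
     (L2norm L (fun x => f x - c i x)%R < (2^-1 ^+ k * B)%:E)%E).

(** Covering at the empirical law of all [n + n] points yields a single partition that is fine on
    both samples; [8 * n] is [4 * (n + n)]. *)
Lemma pooled_partition n (x y : 'I_n -> T) k : (0 < n)%N ->
  exists K (j : (T -> R) -> 'I_K), K%:R <= expR (e k ^+ 2) /\
    forall f g, F f -> F g -> j f = j g ->
      \sum_i (f (x i) - g (x i)) ^+ 2 + \sum_i (f (y i) - g (y i)) ^+ 2 <=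
      8 * (n%:R * (2^-1 ^+ k * B) ^+ 2).
Proof.
move=> n0.
pose z (i : 'I_(n + n)) := match fintype.split i with inl l => x l | inr l => y l end.
have nn0 : (0 < n + n)%N by rewrite addn_gt0 n0.
have rk0 : 0 <= 2^-1 ^+ k * B by rewrite mulr_ge0 ?exprn_ge0 ?invr_ge0// ltW.
have [K [j [Ke jP]]] := empirical_partition z nn0 Ff0 mF rk0 (fun L => cover L k).
exists K, j; split => // f g Ff Fg /(jP f g Ff Fg).
rewrite big_split_ord/= natrD.
have zl i : z (lshift n i) = x i.
  by rewrite /z (_ : fintype.split (lshift n i) = inl i)//; exact: (unsplitK (inl i)).
have zr i : z (rshift n i) = y i.
  by rewrite /z (_ : fintype.split (rshift n i) = inr i)//; exact: (unsplitK (inr i)).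
under eq_bigr do rewrite zl.
under [X in _ + X <= _ -> _]eq_bigr do rewrite zr.
lra.
Qed.

Lemma L1_partition (r : R) : 0 < r -> exists N : R, 0 <= N /\
  forall n (x y : 'I_n -> T), (0 < n)%N ->
  exists K (j : (T -> R) -> 'I_K), K%:R <= N /\
    forall f g, F f -> F g -> j f = j g ->
      \sum_i `|f (x i) - g (x i)| <= n%:R * r /\ \sum_i `|f (y i) - g (y i)| <= n%:R * r.
Proof.
(* The factor 3 is there because its square 9 exceeds the 8 of [pooled_partition]. *)
move=> r0; have [k hk] := half_exp_small (3 * B) r0.
have {}hk := hk k (leqnn _).
exists (expR (e k ^+ 2)); split; first exact: expR_ge0.
move=> n x y n0; have [K [j [Ke jP]]] := pooled_partition x y k n0.
exists K, j; split => // f g Ff Fg /(jP f g Ff Fg) h.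
have sx : 0 <= \sum_i (f (x i) - g (x i)) ^+ 2 by apply: sumr_ge0 => i _; exact: sqr_ge0.
have sy : 0 <= \sum_i (f (y i) - g (y i)) ^+ 2 by apply: sumr_ge0 => i _; exact: sqr_ge0.
have rk : 8 * (n%:R * (2^-1 ^+ k * B) ^+ 2) <= n%:R * r ^+ 2.
  have rk0 : 0 <= 2^-1 ^+ k * B by rewrite mulr_ge0 ?exprn_ge0 ?invr_ge0// ltW.
  have : (3 * (2^-1 ^+ k * B)) ^+ 2 <= r ^+ 2.
    apply: lerXn2r; rewrite ?nnegrE ?(ltW r0) //; [exact: mulr_ge0|].
    by rewrite [2^-1 ^+ k * B]mulrC mulrA.
  rewrite exprMn => h1; rewrite mulrCA; apply: ler_wpM2l => //.
  have := sqr_ge0 (2^-1 ^+ k * B); lra.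
by split; apply: ler_sum_norm_sqrt; rewrite ?(ltW r0)//; lra.
Qed.

Lemma L1_partition_pairs (r : R) : 0 < r -> exists N : R, 0 <= N /\
  forall n (x y : 'I_n -> T), (0 < n)%N ->
  exists K (j : (T -> R) * (T -> R) -> 'I_K), K%:R <= N /\
    forall p q, F p.1 -> F p.2 -> F q.1 -> F q.2 -> j p = j q ->
      \sum_i (`|p.1 (x i) - q.1 (x i)| + `|p.2 (x i) - q.2 (x i)|) +
      \sum_i (`|p.1 (y i) - q.1 (y i)| + `|p.2 (y i) - q.2 (y i)|) <= n%:R * r.
Proof.
move=> r0; have [N [N0 hN]] := L1_partition (divr_gt0 r0 (ltr0n R 4)).
exists (N * N); split; first exact: mulr_ge0.
move=> n x y n0; have [K [j [KN jP]]] := hN n x y n0.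
exists #|{: 'I_K * 'I_K}|, (fun p => enum_rank (j p.1, j p.2)); split.
  by rewrite card_prod card_ord natrM ler_pM.
move=> p q Fp1 Fp2 Fq1 Fq2 /enum_rank_inj[j1 j2].
have [h1 h2] := jP _ _ Fp1 Fq1 j1; have [h3 h4] := jP _ _ Fp2 Fq2 j2.
rewrite !big_split/=; lra.
Qed.


Lemma bounded_difference f g x : F f -> F g -> `|f x - g x| <= 2 * B.
Proof.
by move=> Ff Fg; rewrite mulr_natl mulr2n (le_trans (ler_normB _ _))// lerD// FB.
Qed.

Lemma lln_differences (F2 : set ((T -> R) * (T -> R))) (k c : R) :
  F2 `<=` F `*` F -> 0 < k -> 0 < c ->
  measurable_class [set fg.1 \- fg.2 | fg in F2] ->
  exists n0, forall n, (n0 <= n)%N -> (0 < n)%N ->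
  forall (dW dU : measure_display) (W : measurableType dW) (U : measurableType dU)
    (Pr : probability W R) (PU : probability U R) (nu : probability (n.-tuple U) R)
    (G : W -> {mfun U >-> T}),
  iid_tuple PU nu -> measurable_fun setT (fun wu : W * U => G wu.1 wu.2) ->
  exists E, [/\ measurable E,
    forall w v fg, F2 fg ->
      n%:R * k < `|\sum_(l < n) (fg.1 \- fg.2) (G w (tnth v l)) -
        n%:R * \int[PU]_u (fg.1 \- fg.2) (G w u)| -> E (w, v) &
    ((Pr \x nu) E <= c%:E)%E].
Proof.
move=> F2F k0 c0 mH.
apply: (@uniform_lln R dT T _ F2 (fun fg => fg.1 \- fg.2) (2 * B)) => //.
- by rewrite mulr_gt0.
- move=> fg /F2F[Ff Fg]; split; last by move=> x; exact: bounded_difference.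
  by apply: measurable_funB; exact: mF.
- move=> r r0; have [N [N0 hN]] := L1_partition_pairs r0; exists N; split => // n x y n0.
  have [K [j [KN jP]]] := hN n x y n0; exists K, j; split => // p q /F2F[Fp1 Fp2] /F2F[Fq1 Fq2] jpq.
  apply: (le_trans _ (jP p q Fp1 Fp2 Fq1 Fq2 jpq)).
  have h (z : T) : `|(p.1 \- p.2) z - (q.1 \- q.2) z| <= `|p.1 z - q.1 z| + `|p.2 z - q.2 z|.
    rewrite /= [X in `|X|](_ : _ = (p.1 z - q.1 z) - (p.2 z - q.2 z)); last by ring.
    exact: ler_normB.
  by apply: lerD; apply: ler_sum.
Qed.

Lemma lln_squares (k c : R) : 0 < k -> 0 < c ->
  measurable_class [set (fun x => (fg.1 x - fg.2 x) ^+ 2) | fg in F `*` F] ->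
  exists n0, forall n, (n0 <= n)%N -> (0 < n)%N ->
  forall (dW dU : measure_display) (W : measurableType dW) (U : measurableType dU)
    (Pr : probability W R) (PU : probability U R) (nu : probability (n.-tuple U) R)
    (G : W -> {mfun U >-> T}),
  iid_tuple PU nu -> measurable_fun setT (fun wu : W * U => G wu.1 wu.2) ->
  exists E, [/\ measurable E,
    forall w v fg, (F `*` F) fg ->
      n%:R * k < `|\sum_(l < n) (fg.1 (G w (tnth v l)) - fg.2 (G w (tnth v l))) ^+ 2 -
        n%:R * \int[PU]_u (fg.1 (G w u) - fg.2 (G w u)) ^+ 2| -> E (w, v) &
    ((Pr \x nu) E <= c%:E)%E].
Proof.
move=> k0 c0 mH.
apply: (@uniform_lln R dT T _ (F `*` F) (fun fg x => (fg.1 x - fg.2 x) ^+ 2) ((2 * B) ^+ 2)) => //.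
- by rewrite exprn_gt0// mulr_gt0.
- move=> fg [Ff Fg]; split.
    by apply: measurable_funX; apply: measurable_funB; exact: mF.
  move=> x; rewrite normrX lerXn2r ?nnegrE ?bounded_difference//.
  by rewrite mulr_ge0// ltW.
- move=> r r0.
  have rB0 : 0 < r / (4 * B) by rewrite divr_gt0// mulr_gt0.
  have [N [N0 hN]] := L1_partition_pairs rB0; exists N; split => // n x y n0.
  have [K [j [KN jP]]] := hN n x y n0; exists K, j; split => // p q [Fp1 Fp2] [Fq1 Fq2] jpq.
  (* Squaring is Lipschitz on the relevant range: [a ^+ 2 - b ^+ 2] factors, and the sum factor is
     at most [4 * B]. *)
  have h (z : T) : `|(p.1 z - p.2 z) ^+ 2 - (q.1 z - q.2 z) ^+ 2| <=
      4 * B * (`|p.1 z - q.1 z| + `|p.2 z - q.2 z|).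
    rewrite subr_sqr mulrC normrM ler_pM//.
      apply: (le_trans (ler_normD _ _)).
      have := bounded_difference z Fp1 Fp2; have := bounded_difference z Fq1 Fq2; lra.
    rewrite [X in `|X|](_ : _ = (p.1 z - q.1 z) - (p.2 z - q.2 z)); last by ring.
    exact: ler_normB.
  have := jP p q Fp1 Fp2 Fq1 Fq2 jpq.
  rewrite mulrA ler_pdivlMr ?mulr_gt0// mulrC => hj; apply: (le_trans _ hj).
  by rewrite mulrDr !mulr_sumr; apply: lerD; apply: ler_sum.
Qed.

End BootstrapEquicontinuity.

(** * Asymptotic equicontinuity *)

Section Main.
Context {R : realType} {dT : measure_display} {T : measurableType dT}.

Lemma Rintegral_distribution {dU : measure_display} {U : measurableType dU}
    (PU : probability U R) (X : {mfun U >-> T}) (h : T -> R) (M : R) :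
  measurable_fun setT h -> (forall x, `|h x| <= M) ->
  \int[distribution PU X]_x h x = \int[PU]_u h (X u).
Proof.
move=> mh hM; rewrite /Rintegral; congr fine.
apply: (@integral_distribution _ _ _ _ _ PU X (EFin \o h)); first exact/measurable_EFinP.
exact: (bounded_integrable PU (measurableT_comp mh (measurable_funP X)) (fun u => hM _)).
Qed.

Lemma rho_distribution {dU : measure_display} {U : measurableType dU}
    (PU : probability U R) (X : {mfun U >-> T}) (f g : T -> R) (M : R) :
  measurable_fun setT f -> measurable_fun setT g -> (forall x, `|f x - g x| <= M) ->
  rho (distribution PU X) f g ^+ 2 =
  \int[PU]_u ((f (X u) - g (X u)) - \int[PU]_u' (f (X u') - g (X u'))) ^+ 2.
Proof.
move=> mf mg hM; rewrite /rho sqr_sqrtr; last by apply: Rintegral_ge0 => x _; exact: sqr_ge0.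
have mh : measurable_fun setT (fun x => f x - g x) by exact: measurable_funB.
rewrite (Rintegral_distribution PU X mh hM).
set c := \int[PU]_u' _.
apply: (@Rintegral_distribution _ _ PU X (fun x => (f x - g x - c) ^+ 2) ((M + `|c|) ^+ 2)).
  by apply: measurable_funX; apply: measurable_funB.
move=> x; rewrite normrX lerXn2r ?nnegrE//.
  by rewrite addr_ge0// (le_trans _ (hM x)).
by apply: (le_trans (ler_normB _ _)); rewrite lerD2r.
Qed.

(** Exchanging all coordinates identifies the law of the information with the ghost sample with that
    of the information with the original one. *)
Lemma product_measure_ghost {dW dU : measure_display} {W : measurableType dW}
    {U : measurableType dU} (Pr : probability W R) (PU : probability U R) n
    (nu : probability (n.-tuple U) R) (A : set (W * n.-tuple U)) :
  iid_tuple PU nu -> measurable A ->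
  (((Pr \x nu) \x nu) (fst @^-1` A) = (Pr \x nu) A)%E /\
  (((Pr \x nu) \x nu) ((fun z => (z.1.1, z.2)) @^-1` A) = (Pr \x nu) A)%E.
Proof.
move=> nuPU mA.
have E1 : (((Pr \x nu) \x nu) (fst @^-1` A) = (Pr \x nu) A)%E.
  rewrite (_ : fst @^-1` A = A `*` setT); last by apply/seteqP; split => // z [].
  by rewrite product_measure1E//= probability_setT mule1.
have mfA : measurable (@fst (W * n.-tuple U) (n.-tuple U) @^-1` A).
  by rewrite -[X in measurable X]setTI; exact: measurable_fst.
split => //; rewrite -E1 -[RHS](swap_ghostP Pr nuPU [ffun=> true] mfA).
congr (((Pr \x nu) \x nu)%E _); apply/seteqP; split => -[[w v] v'] /=;
  rewrite /swap_ghost/=.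
  rewrite (_ : [tuple _ | _ < _] = v')//.
  by apply: eq_from_tnth => i; rewrite tnth_mktuple ffunE.
rewrite (_ : [tuple _ | _ < _] = v')//.
by apply: eq_from_tnth => i; rewrite tnth_mktuple ffunE.
Qed.

Variables (F : set (T -> R)) (f0 : T -> R) (B M : R) (e : nat -> R).
Hypotheses (B0 : 0 < B) (Ff0 : F f0) (mF : forall f, F f -> measurable_fun setT f).
Hypothesis FB : forall f x, F f -> `|f x| <= B.
Hypotheses (e0 : forall k, 0 <= e k)
  (eM : forall m, \sum_(0 <= k < m) 2^-1 ^+ k * e k <= M).
Hypothesis cover : forall (L : probability T R) k, exists n, n%:R <= expR (e k ^+ 2) /\
  exists c : 'I_n -> T -> R, (forall i, measurable_fun setT (c i)) /\
  (forall f, F f -> exists i,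
     (L2norm L (fun x => f x - c i x)%R < (2^-1 ^+ k * B)%:E)%E).

(** [C] is the event that close pairs have small [rho_Q]. Its complement enters only through the
    exceptional set of [symmetrization], so it appears with the factor 2. *)
Lemma bootstrap_equicontinuity (eps c : R) : 0 < eps -> 0 < c ->
  exists2 t : R, 0 < t & forall (P : probability T R) (delta : R),
  measurable_class [set fg.1 \- fg.2 | fg in close_pairs P F delta] ->
  measurable_class [set (fun x => (fg.1 x - fg.2 x) ^+ 2) | fg in F `*` F] ->
  exists n0, forall n, (n0 <= n)%N -> (0 < n)%N ->
  forall (dW dU : measure_display) (W : measurableType dW) (U : measurableType dU)
    (Pr : probability W R) (PU : probability U R) (nu : probability (n.-tuple U) R)
    (G : W -> {mfun U >-> T}) (C : set W),
  iid_tuple PU nu -> measurable_fun setT (fun wu : W * U => G wu.1 wu.2) ->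
  measurable C ->
  (forall w fg, C w -> close_pairs P F delta fg ->
    rho (distribution PU (G w)) fg.1 fg.2 <= t) ->
  exists E, [/\ measurable E,
    forall w v fg, C w -> close_pairs P F delta fg ->
      eps * Num.sqrt n%:R < `|\sum_(l < n) (fg.1 \- fg.2) (G w (tnth v l)) -
        n%:R * \int[PU]_u (fg.1 \- fg.2) (G w u)| -> E (w, v) &
    ((Pr \x nu) E <= c%:E + 2%:E * Pr (~` C))%E].
Proof.
move=> eps0 c0.
have [th th0 hth] := @rad_equicontinuity R (4 * B) e M (mulr_gt0 (ltr0n R 4) B0)
  e0 eM (eps / 2) (c / 4) (divr_gt0 eps0 (ltr0n R 2)) (divr_gt0 c0 (ltr0n R 4)).
have B4 : 0 < 1 + 4 * B by rewrite addr_gt0// mulr_gt0.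
(* Chosen with [t] so that [t ^+ 2] and [k * (1 + 4 * B)] are both at most [th ^+ 2 / 8]: four times
   their sum is then at most [th ^+ 2]. The bound by [eps] in [t] serves the variance condition. *)
pose k := th ^+ 2 / (8 * (1 + 4 * B)).
have k0 : 0 < k by rewrite divr_gt0 ?exprn_gt0// mulr_gt0.
pose t := Num.min th eps / 3.
have t0 : 0 < t by rewrite divr_gt0// lt_min th0.
have tth : t ^+ 2 <= th ^+ 2 / 8.
  have : t ^+ 2 <= (th / 3) ^+ 2.
    apply: lerXn2r; rewrite ?nnegrE; [exact: ltW|by rewrite divr_ge0// ltW|].
    by rewrite /t ler_pM2r ?invr_gt0// ge_min lexx.
  have := sqr_ge0 th; lra.
have teps : t ^+ 2 <= eps ^+ 2 / 8.
  have : t ^+ 2 <= (eps / 3) ^+ 2.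
    apply: lerXn2r; rewrite ?nnegrE; [exact: ltW|by rewrite divr_ge0// ltW|].
    by rewrite /t ler_pM2r ?invr_gt0// ge_min lexx orbT.
  have := sqr_ge0 eps; lra.
exists t => // P delta mH1 mH2.
(* Two laws of large numbers on two samples cost [4 * (c / 16) = c / 4]; with the Rademacher bound
   [c / 4], doubling gives [c]. *)
have c160 : 0 < c / 16 by rewrite divr_gt0.
have CPF : close_pairs P F delta `<=` F `*` F by move=> fg [Ff [Fg _]].
have [n1 lln1] := lln_differences B0 Ff0 mF FB cover CPF k0 c160 mH1.
have [n2 lln2] := lln_squares B0 Ff0 mF FB cover k0 c160 mH2.
exists (maxn n1 n2) => n; rewrite geq_max => /andP[nn1 nn2] n0.
move=> dW dU W U Pr PU nu G C nuPU mG mC Ct.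
have [E1 [mE1 E1P PE1]] := lln1 n nn1 n0 dW dU W U Pr PU nu G nuPU mG.
have [E2 [mE2 E2P PE2]] := lln2 n nn2 n0 dW dU W U Pr PU nu G nuPU mG.
have n0' : 0 < n%:R :> R by rewrite ltr0n.
have B20 : 0 < 2 * B by rewrite mulr_gt0.
have mD f g : F f -> F g -> measurable_fun setT (fun x => f x - g x).
  by move=> Ff Fg; apply: measurable_funB; exact: mF.
have BD f g x : F f -> F g -> `|f x - g x| <= 2 * B by exact: bounded_difference.
have var w fg : C w -> close_pairs P F delta fg ->
    \int[PU]_u ((fg.1 (G w u) - fg.2 (G w u)) -
      \int[PU]_u' (fg.1 (G w u') - fg.2 (G w u'))) ^+ 2 <= t ^+ 2.
  move=> Cw fgc; have [Ff Fg] := CPF _ fgc.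
  rewrite -(@rho_distribution _ _ PU (G w) _ _ (2 * B) (mF Ff) (mF Fg)); last first.
    by move=> x; exact: BD.
  by rewrite lerXn2r ?nnegrE ?(ltW t0) ?Ct// /rho sqrtr_ge0.
pose V := n.-tuple U.
pose p2 (z : (W * V) * V) := (z.1.1, z.2).
have mp2 : measurable_fun setT p2.
  by apply: measurable_fun_pair => //; exact: measurableT_comp.
pose D1 := (fun z : (W * V) * V => z.1.1) @^-1` (~` C).
pose D2 := (@fst (W * V) V) @^-1` (E1 `|` E2).
pose D3 := p2 @^-1` (E1 `|` E2).
have mD1 : measurable D1.
  have m11 : measurable_fun setT (fun z : (W * V) * V => z.1.1) by exact: measurableT_comp.
  by rewrite -[X in measurable X]setTI; apply: m11 => //; exact: measurableC.
have mE : measurable (E1 `|` E2) by exact: measurableU.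
have mD2 : measurable D2.
  by rewrite -[X in measurable X]setTI; exact: measurable_fst.
have mD3 : measurable D3.
  by rewrite -[X in measurable X]setTI; exact: mp2.
have [M1 M2] := product_measure_ghost Pr nuPU mE.
have PE : ((Pr \x nu) (E1 `|` E2) <= (c / 8)%:E)%E.
  apply: (le_trans (measureU2 _ mE1 mE2)).
  apply: (le_trans (leeD PE1 PE2)); rewrite -EFinD lee_fin; lra.
have M1' : (((Pr \x nu) \x nu) D2 <= (c / 8)%:E)%E by rewrite /D2 M1.
have M2' : (((Pr \x nu) \x nu) D3 <= (c / 8)%:E)%E by rewrite /D3 M2.
pose D := D1 `|` (D2 `|` D3).
have PD1 : (((Pr \x nu) \x nu) D1 = Pr (~` C))%E.
  rewrite (_ : D1 = (~` C `*` setT) `*` setT); last by apply/seteqP; split => // z [[]].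
  rewrite product_measure1E//; last by apply: measurableX => //; exact: measurableC.
  rewrite /= probability_setT mule1 product_measure1E//; last exact: measurableC.
  by rewrite /= probability_setT mule1.
have PD : (((Pr \x nu) \x nu) D <= Pr (~` C) + (c / 4)%:E)%E.
  apply: (le_trans (measureU2 _ mD1 (measurableU _ _ mD2 mD3))); apply: leeD.
    by rewrite -PD1.
  apply: (le_trans (measureU2 _ mD2 mD3)).
  rewrite (_ : (c / 4) = c / 8 + c / 8); last by lra.
  by rewrite EFinD; exact: leeD M1' M2'.
have s0 : 0 < eps * Num.sqrt n%:R by rewrite mulr_gt0// sqrtr_gt0.
have [||||||E [mE' hE PE']] := @symmetrization R _ _ _ T W U Pr PU n nu G nuPU mG
    [set fg.1 \- fg.2 | fg in close_pairs P F delta] C D (2 * B)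
    (eps * Num.sqrt n%:R) (c / 4) mH1.
- move=> _ [fg fgc <-]; have [Ff Fg] := CPF _ fgc.
  by split; [exact: mD|move=> x; exact: BD].
- by [].
- by rewrite divr_ge0// ltW.
- by apply: measurableU => //; exact: measurableU.
- move=> w _ Cw [fg fgc <-]; rewrite exprMn sqr_sqrtr//.
  have : n%:R * t ^+ 2 <= n%:R * (eps ^+ 2 / 8) by rewrite ler_pM2l.
  have : n%:R * \int[PU]_u ((fg.1 (G w u) - fg.2 (G w u)) -
      \int[PU]_u' (fg.1 (G w u') - fg.2 (G w u'))) ^+ 2 <= n%:R * t ^+ 2.
    by rewrite ler_pM2l// var.
  by move=> h1 h2; apply: (le_trans h1); lra.
- move=> w v v' nDz.
  have Cw : C w by apply: contrapT => nC; apply: nDz; left.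
  have nE1 z : ~ (E1 `|` E2) z -> ~ E1 z by move=> h h'; apply: h; left.
  have nE2 z : ~ (E1 `|` E2) z -> ~ E2 z by move=> h h'; apply: h; right.
  have nv : ~ (E1 `|` E2) (w, v) by move=> h; apply: nDz; right; left.
  have nv' : ~ (E1 `|` E2) (w, v') by move=> h; apply: nDz; right; right.
  pose x l := G w (tnth v l); pose y l := G w (tnth v' l).
  (* The process is indexed by single functions, through their differences between the two samples,
     so that entropy of [F] itself suffices; pairs enter only through the relation. *)
  apply: (le_trans _ (hth n (T -> R) F (fun f l => f (x l) - f (y l)) n0 _
    (fun f g => close_pairs P F delta (f, g)) _)).
  + apply: le_rad_pr => s [_ [[[f g] fgc <-]] /= h]; exists f, g.
    have [Ff Fg] := CPF _ fgc; split => //.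
    rewrite (_ : rad_sum s _ = rad_sum s (fun l =>
      f (G w (tnth v l)) - g (G w (tnth v l)) - (f (G w (tnth v' l)) - g (G w (tnth v' l))))).
      by apply: le_lt_trans h; lra.
    by congr rad_sum; apply/funext => l; rewrite /x /y; ring.
  + move=> j; have [K [i [Ke iP]]] := pooled_partition B0 Ff0 mF cover x y j n0.
    exists K, i; split => // f g Ff Fg /(iP f g Ff Fg) h.
    apply: (@le_trans _ _ (\sum_l (2 * (f (x l) - g (x l)) ^+ 2 + 2 * (f (y l) - g (y l)) ^+ 2))).
      apply: ler_sum => l _.
      have := sqr_ge0 ((f (x l) - g (x l)) + (f (y l) - g (y l))); nra.
    rewrite big_split/= -!mulr_sumr.
    (* The constant [4 * B] fits here: twice the 8 of [pooled_partition] is the square of 4. *)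
    have -> : 4 * B * 2^-1 ^+ j = 4 * (2^-1 ^+ j * B) by ring.
    by rewrite exprMn; lra.
  + move=> f g Ff Fg fgc.
    pose mu1 := \int[PU]_u (f (G w u) - g (G w u)).
    pose mu2 := \int[PU]_u (f (G w u) - g (G w u)) ^+ 2.
    have mfg : measurable_fun setT (fun u => f (G w u) - g (G w u)).
      exact: (measurableT_comp (mD f g Ff Fg) (measurable_funP (G w))).
    have muB : `|mu1| <= 2 * B by apply: (Rintegral_bound PU mfg) => u; exact: BD.
    have muv : mu2 - mu1 ^+ 2 <= t ^+ 2.
      have := var w (f, g) Cw fgc; rewrite (variance_expand PU mfg (M := 2 * B))//.
      by move=> u; exact: BD.
    have lln (u : V) : ~ (E1 `|` E2) (w, u) ->
        `|\sum_l (f (G w (tnth u l)) - g (G w (tnth u l))) - n%:R * mu1| <= n%:R * k /\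
        `|\sum_l (f (G w (tnth u l)) - g (G w (tnth u l))) ^+ 2 - n%:R * mu2| <= n%:R * k.
      move=> nE; split; rewrite leNgt; apply/negP => h.
        by apply: (nE1 _ nE); apply: (E1P w u (f, g)).
      by apply: (nE2 _ nE); apply: (E2P w u (f, g)).
    have [p1 p2'] := lln v nv; have [q1 q2] := lln v' nv'.
    apply: (@le_trans _ _ (n%:R * (4 * (t ^+ 2 + k * (1 + 2 * (2 * B)))))).
      rewrite (eq_bigr (fun l => ((f (x l) - g (x l)) - (f (y l) - g (y l))) ^+ 2)); last first.
        by move=> l _; congr (_ ^+ 2); ring.
      exact: (sum_sqr_difference_le muB (ltW k0) muv).
    rewrite ler_pM2l//.
    have -> : k * (1 + 2 * (2 * B)) = th ^+ 2 / 8.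
      by rewrite /k; field; rewrite lt0r_neq0//.
    lra.
exists E; split => //.
- by move=> w v fg Cw fgc h; apply: hE h => //; exists fg.
- apply: (le_trans PE').
  apply: (@le_trans _ _ (2%:E * ((c / 4)%:E + (Pr (~` C) + (c / 4)%:E)))%E).
    by apply: lee_wpmul2l => //; exact: leeD.
  have Cfin : Pr (~` C) \is a fin_num by apply: fin_num_measure; exact: measurableC.
  rewrite -(fineK Cfin); set r := fine _.
  have -> : (2%:E * ((c / 4)%:E + (r%:E + (c / 4)%:E)) = (2 * (c / 4 + (r + c / 4)))%:E)%E.
    by rewrite !EFinM !EFinD.
  have -> : (c%:E + 2%:E * r%:E = (c + 2 * r)%:E)%E by [].
  rewrite lee_fin; lra.
Qed.

End Main.

(** * Limits superior and conditional probabilities *)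

Section Limsup.
Context {R : realType}.

Lemma limn_esup_lt (v : nat -> \bar R) (x : \bar R) : (limn_esup v < x)%E ->
  exists n0, forall n, (n0 <= n)%N -> (v n <= x)%E.
Proof.
move=> /ereal_inf_lt[_ [V [N _ NV] <-] Vx]; exists N => n Nn.
apply: (le_trans _ (ltW Vx)); apply: ereal_sup_ubound; exists n => //.
exact: NV.
Qed.

Lemma limn_esup_le (u : nat -> \bar R) (x : \bar R) n0 :
  (forall n, (n0 <= n)%N -> (u n <= x)%E) -> (limn_esup u <= x)%E.
Proof.
move=> ux; apply: (@le_trans _ _ (ereal_sup (u @` [set n | (n0 <= n)%N]))).
  apply: ereal_inf_lbound; exists [set n | (n0 <= n)%N] => //.
  by exists n0.
by apply: ge_ereal_sup => _ [n /= n0n <-]; exact: ux.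
Qed.

(** The dominating family may depend on the error [c]; this is essential because the radius at which
    [rho_Q] is tested is chosen after [c]. *)
Lemma limn_esup_cvg0_domination (u : R -> nat -> \bar R) (K : R) : 0 < K ->
  (forall x n, 0 <= u x n)%E ->
  (forall c, 0 < c -> exists v : R -> nat -> \bar R,
    (fun x => limn_esup (v x)) @ 0^'+ --> 0%E /\
    forall x, 0 < x -> exists n0, forall n, (n0 <= n)%N ->
      (u x n <= c%:E + K%:E * v x n)%E) ->
  (fun x => limn_esup (u x)) @ 0^'+ --> 0%E.
Proof.
move=> K0 u0 uv.
have U0 x : (0 <= limn_esup (u x))%E by apply: limf_esup_ge0 => //; case=> N _ /(_ N (leqnn N)).
have near_le c : 0 < c -> \forall x \near 0^'+, (limn_esup (u x) <= c%:E)%E.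
  move=> c0; have c20 : 0 < c / 2 by rewrite divr_gt0.
  have [v [/fine_cvgP[vfin /cvgr0Pnorm_le vc] uvx]] := uv (c / 2) c20.
  have cK0 : 0 < c / (4 * K) by rewrite divr_gt0// mulr_gt0.
  have vcK := vc _ cK0; near=> x.
  have x0 : 0 < x by near: x; exact: nbhs_right_gt.
  have [n1 ux] := uvx x x0.
  have xfin : limn_esup (v x) \is a fin_num by near: x.
  have xc : `|fine (limn_esup (v x))| <= c / (4 * K) by near: x.
  have [n2 vx] : exists n0, forall n, (n0 <= n)%N -> (v x n <= (c / (2 * K))%:E)%E.
    apply: limn_esup_lt; rewrite -(fineK xfin) lte_fin.
    apply: (le_lt_trans (ler_norm _)); apply: (le_lt_trans xc).
    rewrite ltr_pM2l// ltf_pV2 ?posrE ?mulr_gt0//; lra.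
  apply: (@limn_esup_le _ _ (maxn n1 n2)) => n; rewrite geq_max => /andP[n1n n2n].
  apply: (le_trans (ux n n1n)).
  apply: (@le_trans _ _ ((c / 2)%:E + K%:E * (c / (2 * K))%:E)%E).
    by rewrite leeD2l// lee_wpmul2l// ?vx// lee_fin ltW.
  rewrite -EFinM -EFinD lee_fin.
  have -> : K * (c / (2 * K)) = c / 2 by field; rewrite lt0r_neq0.
  lra.
apply/fine_cvgP; split.
  have := near_le 1 ltr01; apply: filterS => x h.
  by rewrite ge0_fin_numE// (le_lt_trans h)// ltry.
apply/cvgr0Pnorm_le => c c0; have := near_le c c0; apply: filterS => x h /=.
rewrite ger0_norm ?fine_ge0// -lee_fin fineK//.
by rewrite ge0_fin_numE// (le_lt_trans h)// ltry.
Unshelve. all: by end_near. Qed.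

End Limsup.

Section Conditioning.
Context {R : realType} {d : measure_display} {W : measurableType d}.
Variables (Pr : probability W R) (O : set (set W)).
Hypothesis sO : sub_sigma_algebra_of O.

Lemma sub_sigma_algebra_measurable (A : set (g_sigma_algebraType O)) :
  measurable A -> O A /\ measurable (A : set W).
Proof.
case: sO => O1 O2; rewrite /measurable/= sigma_algebra_id// => OA.
by split=> //; exact: O2.
Qed.

Lemma measurable_sub_id : measurable_fun setT (fun w : W => w : g_sigma_algebraType O).
Proof. by move=> _ A /sub_sigma_algebra_measurable[_ mA]; rewrite setTI preimage_id. Qed.

(** The integral of [h] over the set where [h] exceeds [c] is [Pr] of the part of [A] in that set,
    since the set belongs to [O]; no sign condition on [h] is involved. *)
Lemma cond_probability_markov (A : set W) (h : W -> R) (c : R) : 0 < c -> measurable A ->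
  is_cond_probability Pr O A h -> (Pr [set w | (c < h w)%R] <= (c^-1)%:E * Pr A)%E.
Proof.
move=> c0 mA [mh ih hA].
have mC : measurable ([set w | c < h w] : set (g_sigma_algebraType O)).
  by rewrite -[X in measurable X]setTI -preimage_itvoy; apply: mh.
have [OC mC'] := sub_sigma_algebra_measurable mC.
rewrite lee_pdivlMl//.
apply: (@le_trans _ _ (\int[Pr]_(w in [set w | (c < h w)%R]) (h w)%:E)%E).
  rewrite -integral_cst//; apply: ge0_le_integral => //.
  - by move=> w _; rewrite lee_fin ltW.
  - by apply: measurable_funTS; exact: (measurable_int Pr ih).
  - by move=> w /= cw; rewrite lee_fin ltW.
rewrite hA//; apply: le_measure; rewrite ?inE//; exact: measurableI.
Qed.

End Conditioning.

(** * Product law of the information and the bootstrap draws *)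

Section JointLaw.
Context {R : realType} {dW dU : measure_display}.
Context {W : measurableType dW} {U : measurableType dU}.
Variables (Pr : probability W R) (O : set (set W)) (n : nat).
Variables (X : 'I_n -> W -> U) (PU : probability U R).
Hypotheses (sO : sub_sigma_algebra_of O) (iidX : iid_given Pr O X PU).

Definition sample_tuple (w : W) : n.-tuple U := [tuple X i w | i < n].

Lemma measurable_sample_tuple : measurable_fun setT sample_tuple.
Proof.
apply/measurable_fun_tnthP => i.
rewrite (_ : _ \o _ = X i); first exact: iidX.1.
by apply/funext => w /=; rewrite tnth_mktuple.
Qed.

(* This is the n-fold product of PU; a second copy of it is the ghost sample. *)
Definition sample_law : probability (n.-tuple U) R :=
  distribution Pr (mfunT measurable_sample_tuple).

Definition restricted_law : probability (g_sigma_algebraType O) R :=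
  distribution Pr (mfunT (measurable_sub_id sO)).

Lemma preimage_sample_cylinder (A : 'I_n -> set U) :
  sample_tuple @^-1` cylinder A = \bigcap_i (X i @^-1` A i).
Proof.
apply/seteqP; split => w /= h i; first by move=> _; have := h i; rewrite tnth_mktuple.
by rewrite tnth_mktuple; exact: h.
Qed.

Lemma sample_cylinder (C : set W) (A : 'I_n -> set U) : O C ->
  (forall i, measurable (A i)) ->
  (Pr (sample_tuple @^-1` cylinder A `&` C) = \prod_(i < n) PU (A i) * Pr C)%E.
Proof.
move=> OC mA; rewrite preimage_sample_cylinder.
have [_ _ /(_ C OC) <-] := iidX.2 A mA.
rewrite integral_cst; last exact: sO.2.
rewrite fineK//; apply: prode_fin_num => i _; exact: fin_num_measure.
Qed.

Lemma sample_law_iid : iid_tuple PU sample_law.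
Proof.
move=> A mA.
have OT : O setT by case: sO => [[sO0 OC _] _]; rewrite -(setD0 setT); exact: OC.
have := sample_cylinder OT mA.
by rewrite setIT probability_setT mule1.
Qed.

Lemma measurable_joint_sample :
  measurable_fun setT (fun w : W => ((w : g_sigma_algebraType O), sample_tuple w)).
Proof.
apply: measurable_fun_pair; last exact: measurable_sample_tuple.
exact: measurable_sub_id.
Qed.

(** Given [O], the probability of a cylinder is a constant, so integrating it over a set of [O]
    factorises; cylinders then determine the joint law. *)
Lemma joint_sample_law (E : set (g_sigma_algebraType O * n.-tuple U)) : measurable E ->
  ((restricted_law \x sample_law) E =
   Pr ((fun w : W => ((w : g_sigma_algebraType O), sample_tuple w)) @^-1` E))%E.
Proof.
move=> mE.
apply: (@product_cylinder_unique _ _ _ _ _ _ restricted_law sample_law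
  (distribution Pr (mfunT measurable_joint_sample))) => // C A mC mA.
have [OC _] := sub_sigma_algebra_measurable sO mC.
rewrite (sample_law_iid mA) muleC -(sample_cylinder OC mA).
by rewrite /distribution/= /pushforward; congr (Pr _); rewrite setIC.
Qed.

End JointLaw.

Lemma modulus_gtP {R : realType} {dT dU : measure_display} {T : measurableType dT}
    {U : measurableType dU} n (P : probability T R) (PU : probability U R)
    (X : {mfun U >-> T}) (z : 'I_n -> T) (F : set (T -> R)) (B delta eps : R) :
  (0 < n)%N -> (forall f, F f -> measurable_fun setT f) -> envelope F (cst B) ->
  (eps%:E < modulus P (distribution PU X) z F delta)%E ->
  exists fg, close_pairs P F delta fg /\
    eps * Num.sqrt n%:R < `|\sum_(i < n) (fg.1 \- fg.2) (z i) -
      n%:R * \int[PU]_u (fg.1 \- fg.2) (X u)|.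
Proof.
move=> n0 mF FB /ereal_sup_gt[_ [[f g] fgc <-]]; rewrite lte_fin => h.
exists (f, g); split => //; have [/= Ff [Fg _]] := fgc.
have sn0 : 0 < Num.sqrt n%:R :> R by rewrite sqrtr_gt0 ltr0n.
have intE k : F k -> \int[distribution PU X]_x k x = \int[PU]_u k (X u).
  by move=> Fk; apply: (@Rintegral_distribution _ _ _ _ _ PU X k B (mF k Fk)) => x; exact: (FB k x Fk).
have int k : F k -> PU.-integrable setT (EFin \o (fun u => k (X u))).
  move=> Fk; apply: (bounded_integrable PU _ (fun u => FB k (X u) Fk)).
  exact: (measurableT_comp (mF k Fk) (measurable_funP X)).
rewrite RintegralB ?int// sumrB.
move: h; rewrite /empirical_process /= !intE//.
set a := \sum_(i < n) f (z i); set b := \sum_(i < n) g (z i).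
set p := \int[PU]_u f (X u); set q := \int[PU]_u g (X u).
set s := Num.sqrt n%:R in sn0 *.
have ns : n%:R = s ^+ 2 by rewrite sqr_sqrtr.
have -> : a - b - n%:R * (p - q) =
    (s * (n%:R^-1 * a - p) - s * (n%:R^-1 * b - q)) * s.
  by rewrite ns; field; rewrite lt0r_neq0.
by rewrite normrM (gtr0_norm sn0) ltr_pM2r.
Qed.

Theorem theorem2p4
  (R : realType) (p : nat)
  (P : probability (euclidean R p) R)
  (* base space and base distribution *)
  (dU : measure_display) (U : measurableType dU) (PU : probability U R)
  (* for each sample size n: the underlying probability space, the information
     info n, the data Z n, the generator G n and the bootstrap draws Ut n *)
  (dW : nat -> measure_display) (W : forall n, measurableType (dW n))
  (Pr : forall n, probability (W n) R)
  (info : forall n, set (set (W n)))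
  (Z : forall n, 'I_n -> W n -> euclidean R p)
  (G : forall n, W n -> {mfun U >-> euclidean R p})
  (Ut : forall n, 'I_n -> W n -> U)
  (hinfo : forall n, sub_sigma_algebra_of (info n))
  (hZ : forall n, iid_from (Pr n) (@Z n) P)
  (hZO : forall n i,
    measurable_fun setT (Z n i : g_sigma_algebraType (info n) -> euclidean R p))
  (hG : forall n, measurable_fun setT
    (fun wu : g_sigma_algebraType (info n) * U => G n wu.1 wu.2))
  (hUt : forall n, iid_given (Pr n) (info n) (@Ut n) PU)
  (* the function class *)
  (F : set (euclidean R p -> R)) (B : R)
  (hF : forall f, F f -> measurable_fun setT f)
  (hB : 0 < B) (hFB : envelope F (cst B))
  (hJ : (uniform_entropy_integral 1 F (cst B) < +oo)%E) :
  let Q n (w : W n) : probability (euclidean R p) R := distribution PU (G n w) in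
  let Zt n (w : W n) : 'I_n -> euclidean R p := fun i => G n w (Ut n i w) in
  (* measurability of the suprema involved *)
  (forall delta, 0 < delta ->
    measurable_class [set fg.1 \- fg.2 | fg in close_pairs P F delta]) ->
  measurable_class
    [set (fun x => (fg.1 x - fg.2 x) ^+ 2) | fg in F `*` F] ->
  (forall n delta, 0 < delta -> measurable_fun setT
    (fun w : g_sigma_algebraType (info n) => sup_rho P (Q n w) F delta)) ->
  (forall n delta, 0 < delta -> measurable_fun setT
    (fun w : W n => modulus P (Q n w) (Zt n w) F delta)) ->
  (* the semimetric condition *)
  (forall eps, 0 < eps ->
    (fun delta => limn_esup (fun n =>
       Pr n [set w | (eps%:E < sup_rho P (Q n w) F delta)%E]))
      @ 0^'+ --> 0%E) ->
  forall eps eta, 0 < eps -> 0 < eta ->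
  (* for any version of the conditional probability given info n *)
  forall PUt : forall (delta : R) (n : nat), W n -> R,
  (forall delta n, 0 < delta -> is_cond_probability (Pr n) (info n)
     [set w | (eps%:E < modulus P (Q n w) (Zt n w) F delta)%E] (PUt delta n)) ->
  (fun delta => limn_esup (fun n => Pr n [set w | eta < PUt delta n w]))
    @ 0^'+ --> 0%E.
Proof.
move=> Q Zt mH1 mH2 msup mmod hrho eps eta eps0 eta0 PUt hPUt.
have mcond delta n : 0 < delta ->
    measurable [set w | (eps%:E < modulus P (Q n w) (Zt n w) F delta)%E].
  move=> d0; rewrite -[X in measurable X]setTI.
  exact: emeasurable_fun_o_infty (mmod n delta d0) _.
have markov delta n : 0 < delta -> (Pr n [set w | (eta < PUt delta n w)%R] <=
    (eta^-1)%:E * Pr n [set w | (eps%:E < modulus P (Q n w) (Zt n w) F delta)%E])%E.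
  by move=> d0; apply: (cond_probability_markov (hinfo n) eta0) (hPUt _ _ d0); exact: mcond.
(* The complement of [C] is counted twice by [bootstrap_equicontinuity] and once more where [C]
   fails; Markov divides by [eta]. *)
have eta30 : 0 < 3 / eta by rewrite divr_gt0.
apply: (limn_esup_cvg0_domination eta30) => // c c0.
have [F0|/set0P[f0 Ff0]] := eqVneq F set0.
  exists (fun _ _ => 0%E); split.
    rewrite (_ : (fun=> _) = cst 0%E); first exact: cvg_cst.
    apply/funext => x; apply/eqP; rewrite eq_le; apply/andP; split.
      exact: (@limn_esup_le _ _ _ 0%N).
    by apply: limf_esup_ge0 => //; case=> N _ /(_ N (leqnn N)).
  move=> delta d0; exists 0%N => n _; apply: (le_trans (markov delta n d0)).
  rewrite (_ : [set w | _] = set0) ?measure0 ?mule0 ?adde0 ?lee_fin ?ltW//.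
  rewrite -subset0 => w /= /ereal_sup_gt[_ [fg [Ff _] _] _].
  by rewrite F0 in Ff.
have FB f x : F f -> `|f x| <= B by exact: hFB.
have [e [M [e0 eM cover]]] := entropy_numbers P hB (ex_intro _ _ Ff0) hJ.
(* The error is scaled by [eta] to survive the division in Markov's inequality. *)
have ceta0 : 0 < c * eta by rewrite mulr_gt0.
have [t t0 main] := bootstrap_equicontinuity hB Ff0 hF FB e0 eM cover eps0 ceta0.
exists (fun delta n => Pr n [set w | (t%:E < sup_rho P (Q n w) F delta)%E]); split.
  exact: hrho.
move=> delta d0; have [n0 mainn] := main P delta (mH1 delta d0) mH2.
exists (maxn n0 1) => n; rewrite geq_max => /andP[n0n n1].
apply: (le_trans (markov delta n d0)).
(* This event belongs to the conditioning sigma-algebra, as the first factor of the product space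
   requires. *)
pose C : set (g_sigma_algebraType (info n)) := [set w | (sup_rho P (Q n w) F delta <= t%:E)%E].
have mC : measurable C.
  by rewrite -[X in measurable X]setTI; exact: emeasurable_fun_infty_c (msup n delta d0) _.
have nCE : ~` C = [set w | (t%:E < sup_rho P (Q n w) F delta)%E].
  by apply/seteqP; split => w /=; rewrite /C/= ltNge => /negP.
have [_ mC'] := sub_sigma_algebra_measurable (hinfo n) mC.
have [_ mnC] := sub_sigma_algebra_measurable (hinfo n) (measurableC mC).
have [|E [mE hE PE]] := mainn n n0n n1 _ _ (g_sigma_algebraType (info n)) U
  (restricted_law (Pr n) (hinfo n)) PU (sample_law (hUt n)) (@G n) C
  (sample_law_iid (hinfo n) (hUt n)) (hG n) mC.
  move=> w fg Cw fgc; rewrite -lee_fin; apply: le_trans Cw.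
  by apply: ereal_sup_ubound; exists fg.
pose E' := (fun w => ((w : g_sigma_algebraType (info n)), sample_tuple (@Ut n) w)) @^-1` E.
have mE' : measurable (E' : set (W n)).
  by rewrite -[X in measurable X]setTI; exact: (measurable_joint_sample (hinfo n) (hUt n)).
have {}PE : (Pr n E' <= (c * eta)%:E + 2%:E * Pr n (~` C))%E.
  by apply: le_trans PE; rewrite (joint_sample_law (hinfo n) (hUt n) mE).
have PA : (Pr n [set w | (eps%:E < modulus P (Q n w) (Zt n w) F delta)%E] <=
    Pr n E' + Pr n (~` C))%E.
  apply: (le_trans _ (measureU2 _ mE' mnC)); apply: le_measure.
  - by rewrite inE; exact: mcond.
  - by rewrite inE; exact: measurableU.
  move=> w /= /(modulus_gtP n1 hF hFB)[fg [fgc h]].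
  have [Cw|nCw] := pselect (C w); last by right.
  left; apply: (hE w _ fg Cw fgc).
  by under eq_bigr do rewrite tnth_mktuple.
rewrite -nCE.
have Cfin : Pr n (~` C) \is a fin_num by exact: fin_num_measure.
move: PE PA; rewrite -(fineK Cfin); set r := fine _ => PE PA.
rewrite muleC lee_pdivrMr//.
apply: (le_trans PA); apply: (le_trans (leeD PE (lexx _))).
have -> : ((c * eta)%:E + 2%:E * r%:E + r%:E = (c * eta + 2 * r + r)%:E)%E by [].
have -> : ((c%:E + (3 / eta)%:E * r%:E) * eta%:E = ((c + 3 / eta * r) * eta)%:E)%E by [].
rewrite lee_fin le_eqVlt; apply/orP; left; apply/eqP.
by field; rewrite lt0r_neq0.
Qed.
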